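(* Let $m\in\mathbb{N}$, $\theta>0$, $\alpha>0$, $q>1$, $A,B>0$, $x_0\in\mathbb{R}$, and let the measurement error distribution $G$ be the $m$-fold convolution of the uniform distribution on $[-\theta,\theta]$, i.e. its characteristic function is $\omega\mapsto[\sin(\theta\omega)/(\theta\omega)]^m$. Let $r:=(\alpha/q)(2m-1-q)$ if $q<2m-1$, $r:=0$ if $q\ge 2m-1$, and $\nu:=\dfrac{\alpha}{2\alpha+2m+1+r}$. Then $$\liminf_{n\to\infty}\Big\{\big(A^{-(2m+1)/\alpha}\,n\big)^{\nu}\;\mathcal{R}^*_n\big[\mathscr{W}_{\alpha,q}(A,B)\big]\Big\}\ge C_2,$$ where $C_2$ is a positive constant independent of $A$.
   Context: Model: one observes an i.i.d. sample $Y_1,\dots,Y_n$ with $Y_i=X_i+\epsilon_i$, where the $X_i$ are i.i.d. with unknown density $f$ on $\mathbb{R}$, the $\epsilon_i$ are i.i.d. with known distribution function $G$, and the $X_i$'s are independent of the $\epsilon_i$'s. $\mathrm{E}_f$ denotes expectation when the density of $X_i$ is $f$. For a class $\mathscr{F}$ of densities, the minimax risk of estimating $f(x_0)$ is $$\mathcal{R}_n^*[\mathscr{F}]:=\inf_{\hat f}\;\sup_{f\in\mathscr{F}}\Big[\mathrm{E}_f|\hat f(x_0)-f(x_0)|^2\Big]^{1/2},$$ the infimum being over all estimators, i.e. all measurable functions $\hat f(x_0)$ of $Y_1,\dots,Y_n$. Functional classes. For $\alpha>0$, $\lfloor\alpha\rfloor:=\max\{n\in\mathbb{N}\cup\{0\}: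 n<\alpha\}$ (strict inequality). $\mathscr{H}_\alpha(A)$ is the class of probability densities $f$ on $\mathbb{R}$ that are $\lfloor\alpha\rfloor$ times continuously differentiable with $|f^{(\lfloor\alpha\rfloor)}(t)-f^{(\lfloor\alpha\rfloor)}(t')|\le A|t-t'|^{\alpha-\lfloor\alpha\rfloor}$ for all $t,t'\in\mathbb{R}$. $\mathscr{N}_q(B)$ is the class of probability densities $f$ with $f(t)\le B|t|^{-q}$ for all $t\in\mathbb{R}$. $\mathscr{W}_{\alpha,q}(A,B):=\mathscr{H}_\alpha(A)\cap\mathscr{N}_q(B)$.
   Formalization: Instead of all A>0, the bound is proved for all A≥A0, with C_2 depending on A0 but not on A, where A0 is any number such that the class W_{α,q}(A',B) is nonempty for some 0<A'<A0; for small A the class is empty and the claim fails. *)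

(* Defs.v *)
From HB Require Import structures.
From mathcomp Require Import all_boot all_order all_algebra.
From mathcomp Require Import all_classical all_reals all_analysis.
From mathcomp Require Import measurable_realfun.

Set Implicit Arguments.
Unset Strict Implicit.
Unset Printing Implicit Defensive.

Import Order.TTheory GRing.Theory Num.Theory.
Import numFieldNormedType.Exports.

Local Open Scope classical_set_scope.
Local Open Scope ring_scope.

Record density (R : realType) := Density {
  pdf :> R -> R ;
  measurable_pdf : measurable_fun [set: measurableTypeR R] (pdf : _ -> R) ;
  pdf_ge0 : forall t, 0 <= pdf t ;
  integral_pdf : (\int[lebesgue_measure]_t (pdf t)%:E = 1)%E }.

Definition density_prob (R : realType) (f : density R)
    (V : set (measurableTypeR R)) : \bar R :=
  (\int[lebesgue_measure]_(t in V) (f t)%:E)%E.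

Section density_prob.
Local Open Scope ereal_scope.
Context (R : realType) (f : density R).

Let density0 : density_prob f set0 = 0.
Proof. by rewrite /density_prob integral_set0. Qed.

Let density_ge0 V : 0 <= density_prob f V.
Proof. by apply: integral_ge0 => t _; rewrite lee_fin pdf_ge0. Qed.

Let density_sigma_additive : semi_sigma_additive (density_prob f).
Proof.
move=> /= F mF tF mUF; rewrite /density_prob; apply: cvg_toP.
  apply: ereal_nondecreasing_is_cvgn => m n mn.
  apply: lee_sum_nneg_natr => // k _ _.
  by apply: integral_ge0 => t _; rewrite lee_fin pdf_ge0.
rewrite ge0_integral_bigcup//=.
- apply: measurable_funTS; apply/measurable_EFinP; exact: measurable_pdf.
- by move=> t _; rewrite lee_fin pdf_ge0.
Qed.

HB.instance Definition _ := isMeasure.Build _ _ _ (density_prob f)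
  density0 density_ge0 density_sigma_additive.

Let density_setT : density_prob f [set: _] = 1.
Proof. exact: integral_pdf. Qed.

HB.instance Definition _ := Measure_isProbability.Build _ _ R
  (density_prob f) density_setT.

End density_prob.

Definition add_pair (R : realType)
    (z : measurableTypeR R * measurableTypeR R) : measurableTypeR R :=
  z.1 + z.2.

Lemma measurable_add_pair (R : realType) :
  measurable_fun [set: _] (@add_pair R).
Proof. exact: measurable_funD. Qed.

HB.instance Definition _ (R : realType) :=
  isMeasurableFun.Build _ _ _ _ (@add_pair R) (@measurable_add_pair R).

Definition conv (R : realType) (P Q : probability (measurableTypeR R) R) :
    probability (measurableTypeR R) R :=
  distribution (P \x Q)%E (@add_pair R).

(* The m-fold convolution of P; the neutral element of [conv] is \d_0. *)
Fixpoint conv_pow (R : realType) (P : probability (measurableTypeR R) R)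
    (m : nat) : probability (measurableTypeR R) R :=
  match m with
  | 0 => \d_(0 : measurableTypeR R)
  | m'.+1 => conv P (conv_pow P m')
  end.

Definition cons_pair d (T : measurableType d) (n : nat)
    (z : T * n.-tuple T) : n.+1.-tuple T := [tuple of z.1 :: z.2].

Lemma measurable_cons_pair d (T : measurableType d) n :
  measurable_fun [set: _] (@cons_pair d T n).
Proof. exact: (measurable_cons measurable_fst measurable_snd). Qed.

HB.instance Definition _ d (T : measurableType d) n :=
  isMeasurableFun.Build _ _ _ _ (@cons_pair d T n) (@measurable_cons_pair d T n).

(* The n-fold product measure, i.e. the joint law of an i.i.d. n-sample of P. *)
Fixpoint iid_law (R : realType) d (T : measurableType d)
    (P : probability T R) (n : nat) : probability (n.-tuple T) R :=
  match n with
  | 0 => \d_([tuple] : 0.-tuple T)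
  | n'.+1 => distribution (P \x iid_law P n')%E (@cons_pair d T n')
  end.

Lemma iid_lawE (R : realType) d (T : measurableType d) (P : probability T R)
    (n : nat) (E : 'I_n -> set T) : (forall i, measurable (E i)) ->
  iid_law P n [set y | forall i, E i (tnth y i)] = (\prod_(i < n) P (E i))%E.
Proof.
elim: n E => [|n IH] E mE.
  by rewrite big_ord0 /= diracE mem_set// => -[].
rewrite big_ord_recl -IH; last by move=> i; exact: mE.
have mtail : measurable
    [set y : n.-tuple T | forall i, E (lift ord0 i) (tnth y i)].
  rewrite [X in measurable X](_ : _ = \bigcap_(i in [set: 'I_n])
      ((fun y : n.-tuple T => tnth y i) @^-1` E (lift ord0 i))).
    apply: fin_bigcap_measurable => // i _; rewrite -[X in measurable X]setTI.
    by apply: (measurable_tnth i) => //; exact: mE.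
  by apply/seteqP; split => y /= H i; [move=> _|]; exact: H.
rewrite -(product_measure1E P (iid_law P n) (mE ord0) mtail).
rewrite /distribution /pushforward /=; congr (_ _).
apply/seteqP; split => -[a y] /=; rewrite /cons_pair /=.
  move=> H; split; first exact: (H ord0).
  by move=> i; have := H (lift ord0 i); rewrite tnthS.
move=> [H0 H1] i; case: (unliftP ord0 i) => [j|] ->; last by [].
by rewrite tnthS; exact: H1.
Qed.

Definition estimator (R : realType) (n : nat) : Type :=
  {mfun n.-tuple (measurableTypeR R) >-> R}.

Definition rmse (R : realType) (G : probability (measurableTypeR R) R)
    (n : nat) (x0 : R) (fhat : estimator R n) (f : density R) : \bar R :=
  poweR 'E_(iid_law (conv (density_prob f) G) n)[
    (fun y => `|fhat y - f x0| ^+ 2)] 2^-1.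

(* The supremum over an empty F is -oo, so F is meant to be nonempty. *)
Definition minimax_risk (R : realType) (G : probability (measurableTypeR R) R)
    (n : nat) (x0 : R) (F : set (density R)) : \bar R :=
  ereal_inf [set ereal_sup [set rmse G x0 fhat f | f in F]
            | fhat in [set: estimator R n]].

(* The largest natural number that is strictly smaller than alpha > 0
   (so that it equals alpha - 1 when alpha is an integer); the range of the
   maximum is bounded only to make it finite, see sfloorP. *)
Definition sfloor (R : realType) (alpha : R) : nat :=
  (\max_(k < (Num.truncn alpha).+1 | (k%:R < alpha)%R) k)%N.

Lemma sfloorP (R : realType) (alpha : R) : 0 < alpha ->
  (sfloor alpha)%:R < alpha /\
  forall k : nat, k%:R < alpha -> (k <= sfloor alpha)%N.
Proof.
move=> a0; split.
  rewrite /sfloor; elim/big_ind : _ => //= x y xa ya.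
  by rewrite /maxn; case: ifP.
move=> k ka; have kt : (k < (Num.truncn alpha).+1)%N.
  by rewrite ltnS truncn_ge_nat ltW// ltW.
exact: (@leq_bigmax_cond _ (fun i : 'I__ => (i%:R < alpha)%R) (fun i => i : nat)
  (Ordinal kt)).
Qed.

Definition continuously_differentiable (R : realType) (k : nat) (f : R -> R) :=
  (forall j : nat, (j < k)%N -> forall t : R, derivable (derive1n j f) t 1) /\
  continuous (derive1n k f).

Definition holder_class (R : realType) (alpha A : R) : set (density R) :=
  [set f | continuously_differentiable (sfloor alpha) f /\
    forall t t' : R,
      `|derive1n (sfloor alpha) f t - derive1n (sfloor alpha) f t'|
        <= A * `|t - t'| `^ (alpha - (sfloor alpha)%:R)].

(* The bound is void at t = 0, where |t|^(-q) is +oo (whereas powR gives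
   0 `^ (- q) = 0). *)
Definition tail_class (R : realType) (q B : R) : set (density R) :=
  [set f | forall t : R, t != 0 -> f t <= B * `|t| `^ (- q)].

(* For fixed alpha, q and B this class increases with A, and it is empty for
   all sufficiently small A: a density below B |t|^(-q) cannot be arbitrarily
   flat. *)
Definition W_class (R : realType) (alpha q A B : R) : set (density R) :=
  holder_class alpha A `&` tail_class q B.

Definition unif_sym (R : realType) (theta : R) (htheta : 0 < theta) :
    probability (measurableTypeR R) R :=
  uniform_prob (gtrN htheta).

Definition rate_r (R : realType) (m : nat) (alpha q : R) : R :=
  if q < 2 * m%:R - 1 then alpha / q * (2 * m%:R - 1 - q) else 0.

Definition rate_nu (R : realType) (m : nat) (alpha q : R) : R :=
  alpha / (2 * alpha + 2 * m%:R + 1 + rate_r m alpha q).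

(* Main.v *)
(** Two-point method. Fix a density f0 of the class which has slack in the
Hölder constant and in the tail bound, and which is at least of order
(1 + |t|)^(-q).  The alternative f1 adds to it a train of equal bumps of width h
and height v = A h^alpha, one at each point of a lattice of step 2 theta, with
slowly varying weights c_j over about M lattice points.  Each bump is an m-th
derivative, and convolving with the uniform distribution turns a derivative into
a difference of step 2 theta; hence convolving f1 - f0 with G replaces the
weights by their m-th differences, of size M^(-m), and gains a factor h^m.
Against the noisy density of f0, which is at least of order M^(-q) on the train,
the chi-square distance is of order v^2 h^(2m+1) M^(q+1-2m).  Positivity and the
tail bound require M^q v to be bounded, so M is of order v^(-1/q) when
q < 2m - 1, and M = 1 otherwise; equating the distance with 1/n gives the
rate. *)

Require Import Defs.
From HB Require Import structures.
From mathcomp Require Import all_boot all_order all_algebra.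
From mathcomp Require Import all_classical all_reals all_analysis.
From mathcomp Require Import measurable_realfun zify ring lra.
Set Implicit Arguments.
Unset Strict Implicit.
Unset Printing Implicit Defensive.
Import Order.TTheory GRing.Theory Num.Theory.
Import numFieldNormedType.Exports.
Local Open Scope classical_set_scope.
Local Open Scope ring_scope.

(** * Densities, convolution and translation of Lebesgue measure *)

(** The characteristic function of G vanishes to order m at the nonzero multiples of pi/theta, and
    these zeros are what slows the rate when q < 2m - 1. A train of step 2 theta with slowly varying
    weights has its spectrum near the multiples of pi/theta; at the multiple 0, where the
    characteristic function equals 1, the bumps themselves vanish to order m because they are m-th
    derivatives. A longer train leaves a fainter noisy trace, but over a region where the noisy null
    density is smaller, and this trade-off decides between large M and M = 1. Everything is carried
    out in space, without Fourier transforms. Uniformity in A: f0 is fixed once, for a threshold A0,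
    and serves every A >= A0. The amplitude is a constant multiple of v with a factor that does not
    see A; once v is fixed, A enters the chi-square bound only through h = (v/A)^(1/alpha), hence as
    A^(-(2m+1)/alpha), which is absorbed in the effective sample size N = A^(-(2m+1)/alpha) n. *)

Section density_integral.
Local Open Scope ereal_scope.
Context (R : realType).
Local Notation mu := (@lebesgue_measure R).
Implicit Types (f : density R) (phi : measurableTypeR R -> \bar R).

Import HBNNSimple.

Lemma measurable_EFin_pdf f :
  measurable_fun [set: measurableTypeR R] (fun x => (f x)%:E).
Proof. apply/measurable_EFinP; exact: measurable_pdf. Qed.

Let integral_density_prob_nnsfun f (g : {nnsfun measurableTypeR R >-> R}) :
  \int[density_prob f]_x (g x)%:E = \int[mu]_x ((g x)%:E * (f x)%:E).
Proof.
under [LHS]eq_integral do rewrite fimfunE -fsumEFin//.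
rewrite [LHS]ge0_integral_fsum//; last 2 first.
  - by move=> r; exact/measurable_EFinP/measurableT_comp.
  - by move=> n x _; rewrite EFinM nnfun_muleindic_ge0.
under [RHS]eq_integral.
  move=> x xD; rewrite fimfunE -fsumEFin// muleC ge0_mule_fsumr; last first.
    by move=> r; rewrite EFinM nnfun_muleindic_ge0.
  over.
rewrite [RHS]ge0_integral_fsum//; last 2 first.
  - move=> r; apply: emeasurable_funM; first exact: measurable_EFin_pdf.
    exact/measurable_EFinP/measurableT_comp.
  - move=> n x _; rewrite EFinM mule_ge0//; last by rewrite nnfun_muleindic_ge0.
    by rewrite lee_fin pdf_ge0.
apply: eq_fsbigr => r _.
have mr : measurable (g @^-1` [set r]) by exact: measurable_funPTI.
have [r0|r0] := ltP r 0%R.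
  have -> : g @^-1` [set r] = set0.
    apply/seteqP; split => x //= gxr; have : (0 <= g x)%R by [].
    by rewrite gxr leNgt r0.
  by rewrite [LHS]integral0_eq ?[RHS]integral0_eq// => x _;
    rewrite indicE in_set0 mulr0 ?mule0.
under eq_integral do rewrite EFinM.
rewrite ge0_integralZl_EFin//; last exact/measurable_EFinP/measurable_indic.
rewrite integral_indic//= setIT /density_prob.
under [RHS]eq_integral do rewrite EFinM muleCA.
rewrite ge0_integralZl_EFin//; last 2 first.
- by move=> x _; rewrite mule_ge0// lee_fin ?pdf_ge0.
- apply: emeasurable_funM; first exact: measurable_EFin_pdf.
  exact/measurable_EFinP/measurable_indic.
congr (_ * _); rewrite [LHS]integral_mkcond; apply: eq_integral => x _.
by rewrite patchE indicE; case: ifPn; rewrite ?mule1 ?mule0.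
Qed.

Lemma integral_density_prob f phi : measurable_fun setT phi ->
  (forall x, 0 <= phi x) ->
  \int[density_prob f]_x phi x = \int[mu]_x (phi x * (f x)%:E).
Proof.
move=> mphi phi0.
pose g := nnsfun_approx measurableT mphi.
transitivity (lim (\int[density_prob f]_x (g n x)%:E @[n --> \oo])).
  rewrite -monotone_convergence//=.
  - apply: eq_integral => ? /[!inE] xD; apply/esym/cvg_lim => //=.
    exact: cvg_nnsfun_approx.
  - by move=> n; exact/measurable_EFinP/measurable_funTS.
  - by move=> n ? _; rewrite lee_fin.
  - by move=> ? _ ? ? mn; rewrite lee_fin; exact/lefP/nd_nnsfun_approx.
transitivity (lim (\int[mu]_x ((g n x)%:E * (f x)%:E) @[n --> \oo])).
  by apply: congr_lim; apply/funext => n; exact: integral_density_prob_nnsfun.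
rewrite -monotone_convergence//=.
- apply: eq_integral => x _; apply/cvg_lim => //=.
  by apply: cvgeZr => //; exact: cvg_nnsfun_approx.
- move=> n; apply: emeasurable_funM; last exact: measurable_EFin_pdf.
  exact/measurable_EFinP/measurable_funTS.
- by move=> n x _; rewrite mule_ge0// lee_fin ?pdf_ge0.
- move=> x _ k l kl; rewrite lee_wpmul2r// ?lee_fin ?pdf_ge0//.
  exact/lefP/nd_nnsfun_approx.
Qed.

Lemma lebesgue_measure_shift (e : R) (A : set (measurableTypeR R)) :
  measurable A ->
  pushforward mu (fun x : measurableTypeR R => (x + e)%R) A = mu A.
Proof.
move=> mA.
have ms : measurable_fun [set: measurableTypeR R]
    ((fun x : measurableTypeR R => x + e)%R : _ -> measurableTypeR R).
  exact: measurable_funD.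
pose s := isMeasurableFun.Build _ _ _ _ _ ms.
pose S : {mfun measurableTypeR R >-> measurableTypeR R} :=
  HB.pack (fun x : measurableTypeR R => (x + e)%R : measurableTypeR R) s.
apply/esym/(@lebesgue_measure_unique R (pushforward mu S)) => //.
move=> X [[a b]] /= ab <-.
rewrite /pushforward.
rewrite (_ : _ @^-1` _ = `](a - e)%R, (b - e)%R]%classic); last first.
  by apply/seteqP; split => x /=; rewrite !in_itv/= ltrBlDr lerBrDr.
rewrite !lebesgue_measure_itv/= !lte_fin ltrD2r.
by case: ifPn => // _; rewrite -!EFinD; congr EFin; ring.
Qed.

Lemma ge0_integral_shift (e : R) phi : measurable_fun setT phi ->
  (forall x, 0 <= phi x) ->
  \int[mu]_x phi (x + e)%R = \int[mu]_x phi x.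
Proof.
move=> mphi phi0.
have ms : measurable_fun [set: measurableTypeR R]
    ((fun x : measurableTypeR R => x + e)%R : _ -> measurableTypeR R).
  exact: measurable_funD.
rewrite -(@ge0_integral_pushforward _ _ _ _ R _ ms mu setT phi)//.
by apply: eq_measure_integral => A mA _; exact: (lebesgue_measure_shift e mA).
Qed.

End density_integral.

Section convolution.
Local Open Scope ereal_scope.
Context (R : realType).
Local Notation mu := (@lebesgue_measure R).
Implicit Types (P Q : probability (measurableTypeR R) R)
  (f : density R) (phi : measurableTypeR R -> \bar R).

Let measurable_comp_add phi : measurable_fun setT phi ->
  measurable_fun setT (phi \o @Defs.add_pair R).
Proof.
by move=> mphi; apply: measurableT_comp => //; exact: Defs.measurable_add_pair.
Qed.

Lemma ge0_integral_conv P Q phi : measurable_fun setT phi ->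
  (forall x, 0 <= phi x) ->
  \int[Defs.conv P Q]_y phi y = \int[Q]_e \int[P]_x phi (x + e)%R.
Proof.
move=> mphi phi0; rewrite /Defs.conv ge0_integral_distribution//.
by rewrite fubini_tonelli2//=; exact: measurable_comp_add.
Qed.

(** Lebesgue density of one observation. It takes extended-real values: a density is only measurable
    here, so its average under Q may be infinite at some points. *)
Definition obs_density f Q (y : R) : \bar R := \int[Q]_e (f (y - e)%R)%:E.

Lemma measurable_pdf_sub f :
  measurable_fun [set: measurableTypeR R * measurableTypeR R]
    (fun z => (f (z.1 - z.2)%R)%:E).
Proof.
apply/measurable_EFinP.
apply: (@measurableT_comp _ _ _ _ _ _ f) => //; first exact: measurable_pdf.
exact: measurable_funB.
Qed.

Lemma measurable_obs_density f Q :
  measurable_fun [set: measurableTypeR R] (obs_density f Q).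
Proof.
have f0 (z : measurableTypeR R * measurableTypeR R) : 0 <= (f (z.1 - z.2)%R)%:E.
  by rewrite lee_fin pdf_ge0.
exact: (@measurable_fun_fubini_tonelli_F _ _ _ _ R Q _ (@measurable_pdf_sub f) f0).
Qed.

Lemma obs_density_ge0 f Q y : 0 <= obs_density f Q y.
Proof. by apply: integral_ge0 => e _; rewrite lee_fin pdf_ge0. Qed.

Lemma integral_conv_density f Q phi : measurable_fun setT phi ->
  (forall x, 0 <= phi x) ->
  \int[Defs.conv (density_prob f) Q]_y phi y =
  \int[mu]_y (phi y * obs_density f Q y).
Proof.
move=> mphi phi0; rewrite ge0_integral_conv//.
have mshift e : measurable_fun [set: measurableTypeR R] (fun y => phi (y + e)%R).
  by apply: measurableT_comp => //; exact: measurable_funD.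
have msub e : measurable_fun [set: measurableTypeR R] (fun y => (f (y - e)%R)%:E).
  apply/measurable_EFinP/(@measurableT_comp _ _ _ _ _ _ f) => //.
    exact: measurable_pdf.
  exact: measurable_funB.
transitivity (\int[Q]_e \int[mu]_y (phi y * (f (y - e)%R)%:E)).
  apply: eq_integral => e _; rewrite integral_density_prob//.
  rewrite -[RHS](@ge0_integral_shift R e)//.
  - by apply: eq_integral => x _; rewrite addrK.
  - exact: emeasurable_funM.
  - by move=> x; rewrite mule_ge0// lee_fin pdf_ge0.
pose F (z : measurableTypeR R * measurableTypeR R) :=
  phi z.1 * (f (z.1 - z.2)%R)%:E.
rewrite -(@fubini_tonelli _ _ _ _ R mu Q F)/=; last 2 first.
- apply: emeasurable_funM; last exact: measurable_pdf_sub.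
  exact: measurableT_comp.
- by move=> z; rewrite mule_ge0// lee_fin pdf_ge0.
apply: eq_integral => y _; rewrite /F/= ge0_integralZl//.
- apply/measurable_EFinP/(@measurableT_comp _ _ _ _ _ _ f) => //.
    exact: measurable_pdf.
  exact: measurable_funB.
- by move=> e _; rewrite lee_fin pdf_ge0.
Qed.

End convolution.

(** * Second-moment domination and the two-point bound *)

Section chi2.
Local Open Scope ereal_scope.

(* Equivalent to an L^2(P0) norm at most sqrt c for dP1/dP0, that is, to a
   chi-square distance at most c - 1; in this form it tensorizes by Tonelli. *)
Definition sq_dominated d (T : measurableType d) (R : realType) (c : R)
    (P0 P1 : probability T R) :=
  forall phi : T -> \bar R, measurable_fun setT phi ->
    (forall x, 0 <= phi x <= 1) ->
    (\int[P1]_x phi x) * (\int[P1]_x phi x)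
      <= c%:E * \int[P0]_x (phi x * phi x).

(** Integrating out the last n coordinates under P1 leaves a function [H] of the first one that is
    again [0, 1]-valued, so the one-observation bound applies to [H]; the induction hypothesis then
    bounds each H(x)^2. *)
Lemma sq_dominated_iid d (T : measurableType d) (R : realType) (c : R)
    (P0 P1 : probability T R) (n : nat) : (0 <= c)%R ->
  sq_dominated c P0 P1 -> sq_dominated (c ^+ n) (iid_law P0 n) (iid_law P1 n).
Proof.
move=> c0 dom; elim: n => [|n IH] phi mphi phi01.
  by rewrite expr0 mul1e /= !integral_dirac//= ?diracT ?mul1e//; exact: emeasurable_funM.
have phi0 x : 0 <= phi x by case/andP: (phi01 x).
have mcons := @measurable_cons_pair d T n.
have msq : measurable_fun setT (fun x => phi x * phi x) by exact: emeasurable_funM.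
have sq0 x : 0 <= phi x * phi x by exact: mule_ge0.
rewrite /= !ge0_integral_distribution//.
have mpc : measurable_fun setT (phi \o @cons_pair d T n).
  by apply: measurableT_comp => //.
have mpc2 : measurable_fun setT ((fun x => phi x * phi x) \o @cons_pair d T n).
  exact: (measurableT_comp msq mcons).
rewrite (fubini_tonelli1 _ mpc)//; last by move=> y; exact: phi0.
rewrite (fubini_tonelli1 _ mpc2)//; last by move=> y; exact: sq0.
rewrite /fubini_F/=.
pose H x := \int[iid_law P1 n]_y phi (cons_pair (x, y)).
have mH : measurable_fun setT H.
  exact: (@measurable_fun_fubini_tonelli_F _ _ _ _ R (iid_law P1 n) _ mpc
    (fun y => phi0 _)).
have mpx x : measurable_fun setT (fun y => phi (cons_pair (x, y))).
  by apply: (@measurableT_comp _ _ _ _ _ _ (phi \o @cons_pair d T n)).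
have H01 x : 0 <= H x <= 1.
  rewrite integral_ge0//=.
  have <- : \int[iid_law P1 n]_y (cst 1 y) = 1.
    by rewrite integral_cst//= probability_setT mule1.
  by apply: ge0_le_integral => // y _; case/andP: (phi01 (cons_pair (x, y))).
apply: (le_trans (dom H mH H01)).
rewrite exprS EFinM -muleA lee_wpmul2l ?lee_fin//.
rewrite -ge0_integralZl_EFin ?exprn_ge0//; last 2 first.
- by move=> x _; apply: integral_ge0 => y _; exact: mule_ge0.
- exact: (@measurable_fun_fubini_tonelli_F _ _ _ _ R (iid_law P0 n) _ mpc2
    (fun y => sq0 _)).
apply: ge0_le_integral => //=.
- by move=> x _; rewrite mule_ge0//; case/andP: (H01 x).
- exact: emeasurable_funM.
- apply: emeasurable_funM => //.
  exact: (@measurable_fun_fubini_tonelli_F _ _ _ _ R (iid_law P0 n) _ mpc2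
    (fun y => sq0 _)).
- by move=> x _; exact: IH.
Qed.

End chi2.

(** Discriminant form of Cauchy-Schwarz: it recovers a product bound from a family of inequalities
    that are linear in a, b, c and so can be proved by integrating pointwise bounds. The best t is a
    / b; when b = 0, a positive a is refuted by t = (c + 1) / a. *)
Lemma sqr_le_of_quadratic (R : realFieldType) (a b c : R) :
  0 <= a -> 0 <= b -> 0 <= c ->
  (forall t, 0 <= t -> 2 * t * a <= t ^+ 2 * b + c) -> a ^+ 2 <= c * b.
Proof.
move=> a0 b0 c0 H.
have [b_0|b_gt0] := leP b 0.
  have -> : b = 0 by apply/eqP; rewrite eq_le b_0.
  have [a_0|a_gt0] := leP a 0; first by rewrite mulr0; nra.
  have := H ((c + 1) / a) _.
  rewrite (_ : b = 0); last by apply/eqP; rewrite eq_le b_0.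
  rewrite mulr0 add0r -!mulrA mulVf ?gt_eqF// mulr1 => /(_ _).
  by rewrite divr_ge0 ?addr_ge0// => /(_ isT); lra.
have := H (a / b) _; rewrite divr_ge0// => /(_ isT) => {}H.
have : 2 * (a / b) * a * b <= ((a / b) ^+ 2 * b + c) * b by rewrite ler_pM2r.
have -> : 2 * (a / b) * a * b = 2 * a ^+ 2 by field; rewrite gt_eqF.
have -> : ((a / b) ^+ 2 * b + c) * b = a ^+ 2 + c * b by field; rewrite gt_eqF.
lra.
Qed.

Section chi2_conv.
Local Open Scope ereal_scope.
Context (R : realType).
Local Notation mu := (@lebesgue_measure R).

Lemma integral_obs_density (f : density R)
    (Q : probability (measurableTypeR R) R) :
  \int[mu]_y obs_density f Q y = 1.
Proof.
have := @integral_conv_density R f Q (cst 1) (measurable_cst _) (fun=> lee01).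
rewrite integral_cst//= probability_setT mule1 => ->.
by apply: eq_integral => y _; rewrite mul1e.
Qed.

Lemma le1_integral_fin d (T : measurableType d) (P : probability T R)
    (phi : T -> \bar R) :
  measurable_fun setT phi -> (forall x, 0 <= phi x <= 1) ->
  exists2 a : R, (0 <= a)%R & \int[P]_x phi x = a%:E.
Proof.
move=> mphi phi01.
have I0 : 0 <= \int[P]_x phi x.
  by apply: integral_ge0 => x _; case/andP: (phi01 x).
have I1 : \int[P]_x phi x <= 1.
  have <- : \int[P]_y (cst 1 y) = 1 by rewrite integral_cst//= probability_setT mule1.
  by apply: ge0_le_integral => // y _; case/andP: (phi01 y).
have Ifin : \int[P]_x phi x \is a fin_num.
  by rewrite ge0_fin_numE// (le_lt_trans I1)// ltry.
exists (fine (\int[P]_x phi x)); last by rewrite fineK.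
exact: fine_ge0.
Qed.

(** The integral of w dominates the chi-square distance, the integral of D^2 / p0; writing D^2 <= w
    l avoids dividing by an extended-real density. With p0, p1 the two noisy densities, one
    integrates 2 t phi p1 + p0 <= t^2 phi^2 p0 + 2 p1 + w for each t >= 0. Both densities have mass
    1, which leaves 2 t a <= t^2 b + 1 + chi. *)
Lemma sq_dominated_conv (f0 f1 : density R)
    (Q : probability (measurableTypeR R) R)
    (D w l : R -> R) (chi : R) :
  measurable_fun [set: measurableTypeR R] w -> (forall y, 0 <= w y)%R ->
  (forall y, 0 < l y)%R ->
  (forall y, (l y)%:E <= obs_density f0 Q y) ->
  (forall y, obs_density f1 Q y = obs_density f0 Q y + (D y)%:E) ->
  (forall y, D y ^+ 2 <= w y * l y)%R ->
  \int[mu]_y (w y)%:E <= chi%:E ->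
  sq_dominated (1 + chi) (Defs.conv (density_prob f0) Q)
    (Defs.conv (density_prob f1) Q).
Proof.
move=> mw w0 l0 lp pD Dw wchi phi mphi phi01.
have chi0 : (0 <= chi)%R.
  rewrite -lee_fin; apply: le_trans wchi.
  by apply: integral_ge0 => y _; rewrite lee_fin.
have phi0 x : 0 <= phi x by case/andP: (phi01 x).
have mp f := @measurable_obs_density R f Q.
have p0 f y := @obs_density_ge0 R f Q y.
have msq : measurable_fun setT (fun x => phi x * phi x) by exact: emeasurable_funM.
have sq0 x : 0 <= phi x * phi x by exact: mule_ge0.
have sq01 x : 0 <= phi x * phi x <= 1.
  rewrite sq0/=; case/andP: (phi01 x) => ? ?.
  by rewrite -(mule1 1) lee_pmul.
have [a a0 aE] := le1_integral_fin (Defs.conv (density_prob f1) Q) mphi phi01.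
have [b b0 bE] := le1_integral_fin (Defs.conv (density_prob f0) Q) msq sq01.
rewrite aE bE -!EFinM lee_fin -expr2; apply: sqr_le_of_quadratic => //.
  by rewrite addr_ge0.
move=> t t0.
move: aE bE; rewrite !integral_conv_density// => aE bE.
have : \int[mu]_y ((2 * t)%:E * (phi y * obs_density f1 Q y) + obs_density f0 Q y)
    <= \int[mu]_y ((t ^+ 2)%:E * (phi y * phi y * obs_density f0 Q y)
        + (2%:E * obs_density f1 Q y + (w y)%:E)).
  apply: ge0_le_integral => //=.
  - by move=> y _; rewrite adde_ge0// !mule_ge0// lee_fin; lra.
  - by apply: emeasurable_funD => //; do 2 apply: emeasurable_funM => //.
  - apply: emeasurable_funD; first by do 2 apply: emeasurable_funM => //.
    apply: emeasurable_funD; first exact: emeasurable_funM.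
    exact/measurable_EFinP.
  (* With p0, p1 = p0 + D the two densities and D^2 <= w l <= w p0, the bound
     reads (t phi p0 - p1)^2 + (w p0 - D^2) >= 0 after multiplication by p0. *)
  move=> y _; rewrite pD.
  have := lp y; have := p0 f0 y; have := phi0 y; case/andP: (phi01 y) => _.
  case: (phi y) => [u| |]//; rewrite !lee_fin => u1 u0.
  case: (obs_density f0 Q y) => [p| |]// _ lep.
    rewrite -?(EFinM,EFinD) !lee_fin in lep *.
    have lgt0 := l0 y; have D2 := Dw y; have wy0 := w0 y.
    have pgt0 : (0 < p)%R by lra.
    have D2p : (D y ^+ 2 <= w y * p)%R by nra.
    rewrite -subr_ge0 -(pmulr_rge0 _ pgt0).
    set d := D y in D2p *; set v := w y in D2p *.
    have -> : (p * (t ^+ 2 * (u * u * p) + (2 * (p + d) + v)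
        - (2 * t * (u * (p + d)) + p))
      = (t * u * p - (p + d)) ^+ 2 + (v * p - d ^+ 2))%R by ring.
    by rewrite addr_ge0 ?sqr_ge0// subr_ge0.
  (* Where the null density is infinite, so is the right-hand side, through its term 2 p1. *)
  have -> : 2 * (+oo + (D y)%:E) + (w y)%:E = +oo :> \bar R.
    by rewrite addye// gt0_muley ?lte_fin// addye.
  rewrite [leRHS]addey ?leey// gt_eqF// (lt_le_trans ltNy0)//.
  by rewrite !mule_ge0// lee_fin ?sqr_ge0.
rewrite ge0_integralD//; last 2 first.
- by move=> y _; rewrite !mule_ge0// lee_fin; lra.
- by do 2 apply: emeasurable_funM => //.
rewrite ge0_integralZl_EFin//; last 3 first.
- by move=> y _; rewrite !mule_ge0.
- by apply: emeasurable_funM.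
- lra.
rewrite aE integral_obs_density.
rewrite ge0_integralD//; last 4 first.
- by move=> y _; rewrite !mule_ge0// lee_fin sqr_ge0.
- by do 2 apply: emeasurable_funM => //.
- by move=> y _; rewrite adde_ge0 ?mule_ge0// lee_fin.
- apply: emeasurable_funD; first exact: emeasurable_funM.
  exact/measurable_EFinP.
rewrite ge0_integralZl_EFin//; last 3 first.
- by move=> y _; rewrite !mule_ge0.
- by apply: emeasurable_funM.
- exact: sqr_ge0.
rewrite bE ge0_integralD//; last 4 first.
- by move=> y _; rewrite mule_ge0.
- exact: emeasurable_funM.
- by move=> y _; rewrite lee_fin.
- exact/measurable_EFinP.
rewrite ge0_integralZl_EFin// integral_obs_density mule1.
have [W WE] : exists W, \int[mu]_x (w x)%:E = W%:E.
  exists (fine (\int[mu]_x (w x)%:E)); rewrite fineK//.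
  rewrite ge0_fin_numE ?(le_lt_trans wchi) ?ltry//.
  by apply: integral_ge0 => y _; rewrite lee_fin.
move: wchi; rewrite WE -?(EFinM,EFinD) !lee_fin; lra.
Qed.

(** The event [E] that S is at least s away from a0 serves as a test. If P1 gives it less than 1/2,
    then with P1-probability above 1/2 the estimator is close to a0, hence at least s away from a1.
    Otherwise domination, applied to the indicator of [E], gives P0 E >= P1(E)^2 / c >= 1 / (4c). *)
Lemma two_point_lower_bound d (T : measurableType d) (P0 P1 : probability T R)
    (c s a0 a1 : R) (S : {mfun T >-> R}) :
  (1 <= c)%R -> (0 <= s)%R -> (2 * s <= `|a0 - a1|)%R -> sq_dominated c P0 P1 ->
  ((s ^+ 2 / (4 * c))%:E <= 'E_P0[fun y => (`|S y - a0| ^+ 2)%R]) \/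
  ((s ^+ 2 / (4 * c))%:E <= 'E_P1[fun y => (`|S y - a1| ^+ 2)%R]).
Proof.
move=> c1 s0 sep dom.
pose E := [set y : T | (s <= `|S y - a0|)%R].
have mabs (a : R) : measurable_fun [set: T] (fun y => `|S y - a|)%R.
  by apply: measurableT_comp => //; exact: measurable_funB.
have msq (a : R) : measurable_fun [set: T] (fun y => (`|S y - a| ^+ 2)%:E).
  by apply/measurable_EFinP; exact: measurable_funX.
have mE : measurable E.
  rewrite (_ : E = (fun y => `|S y - a0|)%R @^-1` `[s, +oo[%classic).
    by rewrite -[X in measurable X]setTI; exact: mabs.
  by apply/seteqP; split => y; rewrite /E/= in_itv/= andbT.
have lower (P : probability T R) (F : set T) (a : R) : measurable F ->
    (forall y, F y -> (s <= `|S y - a|)%R) ->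
    (s ^+ 2)%:E * P F <= 'E_P[fun y => (`|S y - a| ^+ 2)%R].
  move=> mF Fs; rewrite unlock.
  apply: (@le_trans _ _ (\int[P]_(y in F) (s ^+ 2)%:E)).
    by rewrite integral_cst.
  apply: (@le_trans _ _ (\int[P]_(y in F) (`|S y - a| ^+ 2)%:E)).
    apply: ge0_le_integral => //.
    - by move=> y _; rewrite lee_fin sqr_ge0.
    - apply: measurable_funTS; exact: msq.
    - by move=> y Fy; rewrite lee_fin lerXn2r ?nnegrE//; exact: Fs.
  by apply: ge0_subset_integral => //; exact: measurable_funTS.
have P1C := probability_setC P1 mE.
have [x [x0 xE]] : exists x, (0 <= x)%R /\ P1 E = x%:E.
  exists (fine (P1 E)); rewrite fine_ge0// fineK//; exact: fin_num_measure.
have [y [y0 yE]] : exists y, (0 <= y)%R /\ P1 (~` E) = y%:E.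
  exists (fine (P1 (~` E))); rewrite fine_ge0// fineK//; apply: fin_num_measure.
  exact: measurableC.
have [z [z0 zE]] : exists z, (0 <= z)%R /\ P0 E = z%:E.
  exists (fine (P0 E)); rewrite fine_ge0// fineK//; exact: fin_num_measure.
move: P1C; rewrite xE yE -EFinB => -[xy1].
have xz : (x * x <= c * z)%R.
  have := dom (fun t => (\1_E t)%:E) _ _.
  have -> : \int[P0]_t ((\1_E t)%:E * (\1_E t)%:E) = \int[P0]_t (\1_E t)%:E.
    apply: eq_integral => t _; rewrite indicE.
    by case: (_ \in _); rewrite /= ?mule1 ?mule0.
  have PE (P : probability T R) : \int[P]_t (\1_E t)%:E = P E.
    by rewrite integral_indic// setIT.
  rewrite !PE xE zE -!EFinM lee_fin; apply.
  - exact/measurable_EFinP/measurable_indic.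
  - by move=> t; rewrite indicE; case: (_ \in _); rewrite !lee_fin ?lexx ?ler01.
have cgt0 : (0 < 4 * c)%R by lra.
have [xlt|xge] := ltP x (2^-1)%R.
  right; apply: le_trans (lower P1 (~` E) a1 _ _); last 2 first.
  - exact: measurableC.
  - move=> t /negP; rewrite -ltNge => lt.
    have : (`|a0 - a1| <= `|a0 - S t| + `|S t - a1|)%R by exact: ler_distD.
    by rewrite (distrC a0 (S t)); lra.
  rewrite yE -EFinM lee_fin ler_wpM2l ?sqr_ge0//.
  rewrite invf_ple ?posrE//; last lra.
  have : (2^-1 < y)%R by lra.
  move=> ylt; have : (y^-1 <= 2)%R by rewrite invf_ple ?posrE ?ltW//; lra.
  lra.
left; apply: le_trans (lower P0 E a0 mE _) => //.
rewrite zE -EFinM lee_fin ler_wpM2l ?sqr_ge0//.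
rewrite -(ler_pM2l cgt0) divff ?gt_eqF//; nra.
Qed.

End chi2_conv.

(** * Convolution with uniform distributions *)

(** Convolution of F' with the uniform law on [-theta, theta]: smoothing by the noise trades a
    derivative for this centred difference. *)
Definition cdiff (R : realType) (theta : R) (F : R -> R) (y : R) : R :=
  (F (y + theta) - F (y - theta)) / (2 * theta).

Lemma is_derive_continuous (R : realType) (F : R -> R) (f : R -> R) :
  (forall t : R, is_derive t (1 : R) F (f t)) -> continuous F.
Proof.
move=> dF t; apply: differentiable_continuous; apply/derivable1_diffP.
by have [] := dF t.
Qed.

Section uniform_convolution.
Context (R : realType) (theta : R) (htheta : 0 < theta).
Local Notation U := (unif_sym htheta).
Local Notation mu := (@lebesgue_measure R).

Lemma is_derive_comp_addr (F : R -> R) (a t df : R) :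
  is_derive (t + a) (1 : R) F df -> is_derive t (1 : R) (fun s => F (s + a)) df.
Proof.
move=> dF.
have := @is_derive1_comp _ F (fun s : R => s + a) t df 1.
rewrite mulr1; apply => //.
by apply: is_derive_eq; rewrite addr0.
Qed.

Lemma is_derive_cdiff (F : R -> R) (f : R -> R) t :
  (forall t : R, is_derive t (1 : R) F (f t)) ->
  is_derive t (1 : R) (cdiff theta F) (cdiff theta f t).
Proof.
move=> dF.
have d1 := is_derive_comp_addr (dF (t + theta)).
have d2 := is_derive_comp_addr (dF (t - theta)).
rewrite /cdiff; apply: is_derive_eq.
by rewrite scaler0 add0r /GRing.scale/= mulrC.
Qed.

Lemma integral_unif_sym (F f : R -> R) (y : R) :
  (forall t : R, is_derive t (1 : R) F (f t)) -> continuous f ->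
  (forall t, 0 <= f t) ->
  (\int[U]_u (f (y - u))%:E = (cdiff theta F y)%:E)%E.
Proof.
move=> dF cf f0.
have tt := gtrN htheta.
have cfy : continuous (fun u : R => f (y - u)).
  move=> u; apply: continuous_comp; last exact: cf.
  by apply: continuousB; [exact: cst_continuous|exact: cvg_id].
rewrite integral_uniform//; last 2 first.
- by apply/measurable_EFinP; exact: continuous_measurable_fun.
- by move=> u; rewrite lee_fin.
pose H (u : R) := - F (y - u).
have dH (u : R) : is_derive u (1 : R) H (f (y - u)).
  have dy : is_derive u (1 : R) (fun s : R => y - s) (-1).
    by apply: is_derive_eq; rewrite add0r mul1r.
  have dc := @is_derive1_comp _ F (fun s : R => y - s) u (f (y - u)) (-1) (dF _) dy.
  by rewrite /H; apply: is_derive_eq; rewrite mulrN1 opprK.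
rewrite (@continuous_FTC2 _ (fun u => f (y - u)) H)//; last 3 first.
- exact: continuous_subspaceT.
- split.
  + by move=> x _; have [] := dH x.
  + by apply: cvg_at_right_filter; exact: (is_derive_continuous dH).
  + by apply: cvg_at_left_filter; exact: (is_derive_continuous dH).
- by move=> x _; rewrite derive1E; have [_ ->] := dH x.
rewrite -EFinB -EFinM /H /cdiff; congr EFin.
by rewrite opprK; field; rewrite gt_eqF//=; lra.
Qed.

(** One uniform factor turns the top entry [F m.+1] into [cdiff theta (F m)]. The functions
    [cdiff theta (F j)] again form a chain of derivatives, one step shorter, and the induction runs
    on that chain. *)
Lemma integral_conv_pow (m : nat) (F : nat -> R -> R) (y : R) :
  (forall j, (j < m)%N -> forall t : R, is_derive t (1 : R) (F j) (F j.+1 t)) ->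
  continuous (F m) -> (forall t, 0 <= F m t) ->
  (\int[conv_pow U m]_e (F m (y - e))%:E = (iter m (cdiff theta) (F 0) y)%:E)%E.
Proof.
elim: m F y => [|m IH] F y dF cF F0.
  rewrite /= integral_dirac//; last first.
    apply/measurable_EFinP; apply: continuous_measurable_fun.
    move=> u; apply: continuous_comp; last exact: cF.
    by apply: continuousB; [exact: cst_continuous|exact: cvg_id].
  by rewrite diracT mul1e subr0.
have mphi z : measurable_fun [set: measurableTypeR R] (fun e => (F m.+1 (z - e))%:E).
  apply/measurable_EFinP; apply: continuous_measurable_fun.
  move=> u; apply: continuous_comp; last exact: cF.
  by apply: continuousB; [exact: cst_continuous|exact: cvg_id].
rewrite [conv_pow _ _]/= ge0_integral_conv//; last by move=> x; rewrite lee_fin.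
have inner z : (\int[U]_x (F m.+1 (z - x))%:E = (cdiff theta (F m) z)%:E)%E.
  by apply: integral_unif_sym => // t; exact: dF.
transitivity (\int[conv_pow U m]_e (cdiff theta (F m) (y - e))%:E)%E.
  apply: eq_integral => e _; rewrite -inner; apply: eq_integral => x _.
  by congr (F _ _)%:E; ring.
have dc j : (j <= m)%N -> forall t : R,
    is_derive t (1 : R) (cdiff theta (F j)) (cdiff theta (F j.+1) t).
  by move=> jm t; apply: is_derive_cdiff => s; exact: dF.
rewrite iterSr; apply: (IH (fun j => cdiff theta (F j)) y).
- by move=> j jm; apply: dc; exact: ltnW.
- exact: is_derive_continuous (dc m (leqnn m)).
- move=> t; rewrite -lee_fin -inner; apply: integral_ge0 => x _.
  by rewrite lee_fin.
Qed.

Lemma iter_cdiffD (F G : R -> R) m y :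
  iter m (cdiff theta) (fun t => F t + G t) y =
  iter m (cdiff theta) F y + iter m (cdiff theta) G y.
Proof.
elim: m y => //= m IH y; rewrite {1}/cdiff !IH /cdiff; field.
by rewrite gt_eqF.
Qed.

Lemma is_derive_monomial (c : R) (k : nat) (t : R) :
  is_derive t (1 : R) (fun t => c * t ^+ k.+1 / k.+1`!%:R) (c * t ^+ k / k`!%:R).
Proof.
pose p : {poly R} := (c / k.+1`!%:R) *: 'X^(k.+1).
rewrite [X in is_derive _ _ X _](_ : _ = horner p); last first.
  by apply/funext => s; rewrite hornerZ hornerXn; ring.
apply: is_derive_eq; rewrite derivZ derivXn hornerZ hornerMn hornerXn.
rewrite factS natrM -[t ^+ _ *+ _]mulr_natr /=; field.
by rewrite nat1r !pnatr_eq0 -!lt0n fact_gt0.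
Qed.

(* Adding the constant C, itself an m-th derivative, makes every integrand
   nonnegative, so that no integrability is needed. *)
Lemma obs_density_perturb (m : nat) (f0 f1 : density R) (F : nat -> R -> R)
    (C y : R) :
  (forall j, (j < m)%N -> forall t : R, is_derive t (1 : R) (F j) (F j.+1 t)) ->
  continuous (F m) -> (forall t, `|F m t| <= C) ->
  (forall t, f1 t = f0 t + F m t) ->
  (obs_density f1 (conv_pow U m) y =
   obs_density f0 (conv_pow U m) y + (iter m (cdiff theta) (F 0) y)%:E)%E.
Proof.
move=> dF cF FC f1E.
have C0 : 0 <= C by exact: le_trans (FC 0).
set Q := conv_pow U m.
pose K j (t : R) := C * t ^+ (m - j) / (m - j)`!%:R.
have KE t : K m t = C by rewrite /K subnn expr0 fact0 mulr1 divr1.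
have dK j : (j < m)%N -> forall t : R, is_derive t (1 : R) (K j) (K j.+1 t).
  move=> jm t; rewrite /K.
  have -> : (m - j = (m - j.+1).+1)%N by rewrite subnSK.
  exact: is_derive_monomial.
have cK : continuous (K m).
  have -> : K m = cst C by apply/funext => t; rewrite KE.
  exact: cst_continuous.
have QK : (\int[Q]_e C%:E = C%:E)%E.
  by rewrite integral_cst//= probability_setT mule1.
have iK : iter m (cdiff theta) (K 0) y = C.
  apply: EFin_inj; rewrite -(integral_conv_pow y dK cK).
    by rewrite -QK; apply: eq_integral => e _; rewrite KE.
  by move=> t; rewrite KE.
pose FK j t := F j t + K j t.
have FC0 t : 0 <= F m t + C by have := FC t; rewrite ler_norml => /andP[]; lra.
have dFK j : (j < m)%N -> forall t : R, is_derive t (1 : R) (FK j) (FK j.+1 t).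
  by move=> jm t; have d1 := dF _ jm t; have d2 := dK _ jm t; exact: is_deriveD.
have cFK : continuous (FK m).
  by move=> t; apply: continuousD; [exact: cF|exact: cK].
have FK0 t : 0 <= FK m t by rewrite /FK KE.
have iFK : (\int[Q]_e (F m (y - e) + C)%:E =
    (iter m (cdiff theta) (F 0) y)%:E + C%:E)%E.
  rewrite -{2}iK -EFinD -iter_cdiffD -(integral_conv_pow y dFK cFK FK0).
  by apply: eq_integral => e _; rewrite /FK KE.
have msub (g : R -> R) : measurable_fun [set: measurableTypeR R] g ->
    measurable_fun [set: measurableTypeR R] (fun e => (g (y - e))%:E).
  move=> mg; apply/measurable_EFinP/(@measurableT_comp _ _ _ _ _ _ g) => //.
  exact: measurable_funB.
have key : (obs_density f1 Q y + C%:E =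
    obs_density f0 Q y + (iter m (cdiff theta) (F 0) y)%:E + C%:E)%E.
  rewrite -[RHS]addeA -iFK -{1}QK /obs_density -!ge0_integralD//.
  - by apply: eq_integral => e _ /=; rewrite -!EFinD f1E addrA.
  - by move=> e _; rewrite lee_fin pdf_ge0.
  - by apply: msub; exact: measurable_pdf.
  - by move=> e _; rewrite lee_fin.
  - apply: (msub (fun t => F m t + C)); apply: measurable_funD => //.
    exact: continuous_measurable_fun.
  - by move=> e _; rewrite lee_fin pdf_ge0.
  - by apply: msub; exact: measurable_pdf.
have := congr1 (fun z => z - C%:E)%E key.
by rewrite !addeK.
Qed.

End uniform_convolution.

(** * Polynomial lower bound on the noisy density *)

Section obs_lower.
Context (R : realType).

Lemma probability_half_ball (Q : probability (measurableTypeR R) R) :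
  exists2 K : nat, (0 < K)%N & (2^-1%:E <= Q `[(- K%:R)%R, K%:R%R]%classic)%E.
Proof.
pose A (n : nat) : set (measurableTypeR R) := `[- n%:R, n%:R]%classic.
have mA n : measurable (A n) by exact: measurable_itv.
have mUA : measurable (\bigcup_n A n) by exact: bigcupT_measurable.
have ndA : nondecreasing_seq A.
  move=> i j ij; apply/subsetPset => x; rewrite /A/= !in_itv/= => /andP[xi xj].
  have : i%:R <= j%:R :> R by rewrite ler_nat.
  by move=> ?; apply/andP; split; lra.
have UA : \bigcup_n A n = [set: measurableTypeR R].
  apply/seteqP; split => // x _; exists (Num.truncn `|x|).+1 => //.
  by rewrite /A/= in_itv/= -ler_norml ltW// truncnS_gt.
have cvA : Q \o A @ \oo --> (1 : \bar R)%E.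
  rewrite (_ : 1%E = Q (\bigcup_n A n)); first exact: nondecreasing_cvg_mu.
  by rewrite UA; apply/esym; exact: probability_setT.
have : \forall n \near \oo, (2^-1%:E < (Q \o A) n)%E.
  have := cvA _ (@open_nbhs_nbhs _ _ _ (conj (@open_ereal_gt_ereal R 2^-1%:E) _)).
  rewrite /= => /(_ _)[|]; first by rewrite lte_fin invf_lt1//; lra.
  by move=> N _ HN; exists N.
case=> N _ HN; exists N.+1 => //.
by apply: ltW; apply: (HN N.+1) => /=.
Qed.

(** Noise of any law stays in some [-K, K] with probability at least 1/2, and there 1 + |y - e| <=
    (1 + K)(1 + |y|). So convolution preserves a polynomial lower bound up to the factor 1 / (2 (1 +
    K)^q). *)
Lemma obs_density_lower (Q : probability (measurableTypeR R) R) (q : R) : 0 <= q ->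
  exists2 k : R, 0 < k & forall (f : density R) (c : R), 0 < c ->
    (forall t, c / (1 + `|t|) `^ q <= f t) ->
    forall y, ((k * c / (1 + `|y|) `^ q)%:E <= obs_density f Q y)%E.
Proof.
move=> q0; have [K K0 QK] := probability_half_ball Q.
have KR : 0 < K%:R :> R by rewrite ltr0n.
exists ((2 * (1 + K%:R) `^ q)^-1).
  by rewrite invr_gt0 mulr_gt0// powR_gt0//; lra.
move=> f c c0 fc y.
pose B : set (measurableTypeR R) := `[- K%:R, K%:R]%classic.
have mB : measurable B by exact: measurable_itv.
have mf : measurable_fun [set: measurableTypeR R] (fun e => (f (y - e))%:E).
  apply/measurable_EFinP/(@measurableT_comp _ _ _ _ _ _ f) => //.
    exact: measurable_pdf.
  exact: measurable_funB.
have f0 e : (0 <= (f (y - e))%:E)%E by rewrite lee_fin pdf_ge0.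
apply: (@le_trans _ _ (\int[Q]_(e in B) (f (y - e))%:E)%E); last first.
  by apply: ge0_subset_integral => //.
set v := c / ((1 + K%:R) `^ q * (1 + `|y|) `^ q).
have p1 : 0 < (1 + K%:R) `^ q :> R by rewrite powR_gt0//; lra.
have p2 : 0 < (1 + `|y|) `^ q :> R by rewrite powR_gt0// ltr_pwDl.
have v0 : 0 < v by rewrite divr_gt0// mulr_gt0.
apply: (@le_trans _ _ (\int[Q]_(e in B) v%:E)%E).
  rewrite integral_cst//= (_ : _ * _ / _ = v * 2^-1).
    by rewrite EFinM lee_wpmul2l// lee_fin ltW.
  by rewrite /v; field; rewrite !gt_eqF.
apply: ge0_le_integral => //.
- by move=> e _; rewrite lee_fin ltW.
- exact: measurable_funTS.
move=> e; rewrite /B/= in_itv/= -ler_norml => eK.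
rewrite lee_fin; apply: le_trans (fc _).
have p3 : 0 < (1 + `|y - e|) `^ q by rewrite powR_gt0// ltr_pwDl.
rewrite /v ler_pM2l// lef_pV2 ?posrE ?mulr_gt0//.
rewrite -powRM; [|lra|exact: addr_ge0].
apply: ge0_ler_powR => //; rewrite ?nnegrE ?addr_ge0 ?mulr_ge0//.
have := ler_normB y e; have := normr_ge0 y; nra.
Qed.

End obs_lower.

(** * Weights of the bump train *)

Section lattice_action.
Context (R : realType) (theta : R).
Implicit Types (p : {poly R}) (F : R -> R).

(** The weights are encoded by their generating polynomial: translation by 2 theta becomes
    multiplication by X, and a difference of step 2 theta becomes multiplication by 1 - X. *)
Definition lattice_conv p F (t : R) : R :=
  \sum_(i < size p) p`_i * F (t - 2 * theta * i%:R).

Lemma lattice_convE p F t (n : nat) : (size p <= n)%N ->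
  lattice_conv p F t = \sum_(i < n) p`_i * F (t - 2 * theta * i%:R).
Proof.
move=> pn; rewrite /lattice_conv.
rewrite (big_ord_widen _ (fun i => p`_i * F (t - 2 * theta * i%:R)) pn).
rewrite big_mkcond; apply: eq_bigr => i _; case: ltnP => // si.
by rewrite nth_default ?mul0r.
Qed.

Lemma lattice_conv_mul1BX p F t :
  lattice_conv ((1 - 'X) * p) F t =
  lattice_conv p F t - lattice_conv p F (t - 2 * theta).
Proof.
have s1 : (size ((1 - 'X) * p)%R <= (size p).+1)%N.
  apply/leq_sizeP => j pj; rewrite mulrBl mul1r coefB coefXM.
  case: j pj => // j pj; rewrite /= !nth_default ?subrr//.
  exact: ltnW.
rewrite (lattice_convE _ _ s1) (lattice_convE F t (leqnSn (size p))).
rewrite /lattice_conv !big_ord_recl /= mulrBl mul1r coefB coefXM/= subr0.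
rewrite -addrA; congr (_ + _); rewrite -sumrB; apply: eq_bigr => i _.
rewrite /bump/= add1n coefB coefXM/= mulrBl; congr (_ - _ * F _).
by rewrite -natr1; ring.
Qed.

Definition ones (M : nat) : {poly R} := \sum_(i < M) 'X^i.

Lemma coef_ones_mul M p j :
  (ones M * p)`_j = \sum_(i < M) (if (j < i)%N then 0 else p`_(j - i)).
Proof.
by rewrite /ones mulr_suml coef_sum; apply: eq_bigr => i _; rewrite coefXnM.
Qed.

Lemma coef_onesX_ge0 M k j : 0 <= (ones M ^+ k)`_j.
Proof.
elim: k j => [|k IH] j; first by rewrite expr0 coef1; case: eqP.
by rewrite exprS coef_ones_mul; apply: sumr_ge0 => i _; case: ifP.
Qed.

(** Each further factor [ones M] replaces a coefficient by a sum of at most M of them, which costs a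
    factor M; hence the normalization by M^m in the train. *)
Lemma coef_onesX_le M k j : (0 < M)%N -> (ones M ^+ k.+1)`_j <= M%:R ^+ k.
Proof.
move=> M0; elim: k j => [|k IH] j.
  rewrite expr1 -[ones M]mulr1 coef_ones_mul expr0.
  have [jM|jM] := ltnP j M.
    rewrite (bigD1 (Ordinal jM))//= ltnn subnn coef1/= big1 ?addr0// => i.
    rewrite -val_eqE/= => ij; case: ltnP => // ji.
    rewrite coef1; case: eqP => // /eqP; rewrite subn_eq0 => ij'.
    by move: ij; rewrite eqn_leq ij' ji.
  rewrite big1 ?ler01// => i _; case: ltnP => // ji; rewrite coef1.
  by case: eqP => // /eqP; rewrite subn_eq0 leqNgt (leq_trans (ltn_ord i)).
rewrite exprS coef_ones_mul.
apply: (@le_trans _ _ (\sum_(i < M) M%:R ^+ k)).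
  by apply: ler_sum => i _; case: ifP => _; rewrite ?exprn_ge0//.
by rewrite sumr_const card_ord -[leLHS]mulr_natl -exprS.
Qed.

Lemma size_onesX M k : (0 < M)%N -> (size (ones M ^+ k)%R <= (M.-1 * k).+1)%N.
Proof.
move=> M0; apply: (leq_trans (size_poly_exp_leq _ _)).
rewrite ltnS leq_mul2r; apply/orP; right.
apply: (@leq_trans (M.-1)) => //.
have : (size (ones M) <= M)%N.
  apply/leq_sizeP => j Mj; rewrite /ones coef_sum big1// => i _.
  by rewrite coefXn gtn_eqF// (leq_trans (ltn_ord i)).
by case: (size _) => // s; case: M M0.
Qed.

(* The (m+1)-fold convolution of the uniform weights on {0, ..., M-1}, scaled to
   height of order 1: one factor more than the number of differences, so that the
   m-th differences are of size M^(-m) everywhere. *)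
Definition train_coef (m M : nat) : {poly R} := (M%:R ^- m) *: ones M ^+ m.+1.

Lemma train_coef_bound m M j : (0 < M)%N -> 0 <= (train_coef m M)`_j <= 1.
Proof.
move=> M0; rewrite coefZ; have M0R : 0 < M%:R :> R by rewrite ltr0n.
rewrite mulr_ge0 ?invr_ge0 ?exprn_ge0 ?coef_onesX_ge0//=.
rewrite -[leRHS](@mulVf _ (M%:R ^+ m : R)) ?expf_neq0 ?gt_eqF//.
by rewrite ler_wpM2l ?invr_ge0 ?exprn_ge0 ?coef_onesX_le.
Qed.

Lemma size_train_coef m M : (0 < M)%N -> (size (train_coef m M) <= m.+1 * M)%N.
Proof.
move=> M0; apply: (leq_trans (size_scale_leq _ _)).
apply: (leq_trans (size_onesX _ M0)).
by case: M M0 => // M _ /=; rewrite [(m.+1 * M.+1)%N]mulnS [(M * _)%N]mulnC; lia.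
Qed.

(** Pigeonhole: the coefficients add up to the value of the polynomial at 1, which is M, and there
    are at most (m + 1) M of them. The index found is the lattice point that will be placed at
    x0. *)
Lemma train_coef_peak m M : (0 < M)%N ->
  exists2 j : nat, (j < m.+1 * M)%N & m.+1%:R^-1 <= (train_coef m M)`_j.
Proof.
move=> M0; have M0R : 0 < M%:R :> R by rewrite ltr0n.
apply: contrapT => none.
have lt_j (j : 'I_(m.+1 * M)) : (train_coef m M)`_j < m.+1%:R^-1.
  by rewrite ltNge; apply/negP => le_j; apply: none; exists j.
have sumc : \sum_(j < m.+1 * M) (train_coef m M)`_j = M%:R.
  transitivity ((train_coef m M).[1]).
    rewrite (horner_coef_wide _ (size_train_coef m M0)).
    by apply: eq_bigr => j _; rewrite expr1n mulr1.
  rewrite hornerZ horner_exp /ones horner_sum.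
  under eq_bigr do rewrite hornerXn expr1n.
  rewrite sumr_const card_ord exprS.
  by rewrite mulrCA mulVf ?mulr1 ?expf_neq0 ?gt_eqF.
have : \sum_(j < m.+1 * M) (train_coef m M)`_j < \sum_(j < m.+1 * M) m.+1%:R^-1.
  have mM : (0 < m.+1 * M)%N by rewrite muln_gt0.
  apply: ltr_sum => [|j _]; last exact: lt_j.
  by apply/hasP; exists (Ordinal mM); rewrite ?mem_index_enum.
rewrite sumc sumr_const card_ord -[ltRHS]mulr_natl natrM.
by rewrite mulrAC divff ?pnatr_eq0// mul1r ltxx.
Qed.

Definition diff_coef (m M : nat) : {poly R} := (1 - 'X) ^+ m * train_coef m M.

(** Since (1 - X) times [ones M] telescopes to 1 - X^M, the m differences consume m of the m + 1
    factors [ones M]. *)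
Lemma diff_coefE m M :
  diff_coef m M = (M%:R ^- m) *: ((1 - 'X^M) ^+ m * ones M).
Proof.
rewrite /diff_coef /train_coef -scalerAr; congr (_ *: _).
rewrite exprSr mulrA -exprMn; congr (_ ^+ _ * _).
have := subrX1 ('X : {poly R}) M; rewrite -/(ones M) => E.
by rewrite -(opprB 'X^M) E -mulNr opprB.
Qed.

Lemma size_diff_coef m M : (0 < M)%N -> (size (diff_coef m M) <= m.+1 * M)%N.
Proof.
move=> M0; rewrite diff_coefE; apply: (leq_trans (size_scale_leq _ _)).
have s1 : (size (ones M) <= M)%N.
  by have := @size_onesX M 1 M0; rewrite expr1 muln1 prednK.
elim: m => [|m IH]; first by rewrite expr0 mul1r mul1n.
rewrite exprS -mulrA mulrBl mul1r (leq_trans (size_polyD _ _))// geq_max.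
rewrite (leq_trans IH) ?leq_mul2r ?leqnSn ?orbT//= size_polyN.
apply/leq_sizeP => j Mj; rewrite coefXnM.
case: ltnP => // Mj'; apply: nth_default; apply: leq_trans IH _.
by rewrite leq_subRL// mulSn in Mj *.
Qed.

(** Multiplication by 1 - X^M at most doubles the largest coefficient in absolute value, and the one
    remaining factor [ones M] has coefficients in [0, 1]. *)
Lemma diff_coef_bound m M j : (0 < M)%N ->
  `|(diff_coef m M)`_j| <= 2 ^+ m / M%:R ^+ m.
Proof.
move=> M0; rewrite diff_coefE coefZ normrM mulrC.
have M0R : 0 < M%:R :> R by rewrite ltr0n.
rewrite [`|M%:R ^- m|]ger0_norm ?invr_ge0 ?exprn_ge0//.
rewrite ler_pM2r ?invr_gt0 ?exprn_gt0//.
elim: m j => [|m IH] j.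
  rewrite expr0 mul1r expr0 -[ones M]expr1 ger0_norm ?coef_onesX_ge0//.
  by have := @coef_onesX_le M 0 j M0; rewrite expr0.
rewrite exprS -mulrA mulrBl mul1r coefB coefXnM exprS mulr_natl mulr2n.
apply: (le_trans (ler_normB _ _)); apply: lerD => //.
by case: ifP => _ //; rewrite normr0 exprn_ge0.
Qed.

End lattice_action.

(** * Chains of derivatives and Hölder bounds *)

(** Derivatives are carried explicitly, and a chain may start below the function of interest: the
    perturbation of the density will be entry m of its chain, while the noisy densities see entry
    0. *)
Definition deriv_chain (R : realType) (k : nat) (F : nat -> R -> R) :=
  forall j, (j < k)%N -> forall t : R, is_derive t (1 : R) (F j) (F j.+1 t).

Definition holder (R : realType) (b L : R) (g : R -> R) :=
  forall t t' : R, `|g t - g t'| <= L * `|t - t'| `^ b.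

Section chains.
Context (R : realType).
Implicit Types (F : nat -> R -> R) (f g : R -> R).

Lemma derive1n_chain k F j : deriv_chain k F -> (j <= k)%N ->
  derive1n j (F 0) = F j.
Proof.
move=> dF; elim: j => [|j IH] jk; first by rewrite derive1n0.
rewrite derive1nS IH; last exact: ltnW.
by apply/funext => t; rewrite derive1E; have [_ ->] := dF j jk t.
Qed.

Lemma chain_continuously_differentiable k F : deriv_chain k F ->
  continuous (F k) -> continuously_differentiable k (F 0).
Proof.
move=> dF cF; split => [j jk t|]; rewrite (derive1n_chain dF)//; last exact: ltnW.
by have [] := dF j jk t.
Qed.

Lemma continuously_differentiable_chain k f : continuously_differentiable k f ->
  deriv_chain k (fun j => derive1n j f).
Proof.
move=> [df _] j jk t; rewrite derive1nS derive1E.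
exact/derivableP/df.
Qed.

Lemma deriv_chain_lincomb k F G (a b : R) :
  deriv_chain k F -> deriv_chain k G ->
  deriv_chain k (fun j t => a * F j t + b * G j t).
Proof.
move=> dF dG j jk t.
have d1 := is_deriveZ a (dF j jk t).
have d2 := is_deriveZ b (dG j jk t).
exact: is_deriveD.
Qed.

Lemma continuous_lincomb f g (a b : R) : continuous f -> continuous g ->
  continuous (fun t => a * f t + b * g t).
Proof.
move=> cf cg t; apply: cvgD; apply: cvgM.
- exact: cvg_cst.
- exact: cf.
- exact: cvg_cst.
- exact: cg.
Qed.

Lemma holder_lincomb b L1 L2 f g (u v : R) : 0 <= u -> 0 <= v ->
  holder b L1 f -> holder b L2 g ->
  holder b (u * L1 + v * L2) (fun t => u * f t + v * g t).
Proof.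
move=> u0 v0 hf hg t t'.
have -> : u * f t + v * g t - (u * f t' + v * g t') =
  u * (f t - f t') + v * (g t - g t') by ring.
apply: (le_trans (ler_normD _ _)); rewrite mulrDl -!mulrA !normrM.
by rewrite !(ger0_norm u0) !(ger0_norm v0) lerD ?ler_wpM2l.
Qed.

Lemma sfloor_exponent (alpha : R) : 0 < alpha ->
  0 < alpha - (sfloor alpha)%:R <= 1.
Proof.
move=> a0; have [kla klub] := sfloorP a0.
rewrite subr_gt0 kla/= lerBlDl leNgt; apply/negP => ka.
have : ((sfloor alpha).+1 <= sfloor alpha)%N by apply: klub; rewrite -natr1.
by rewrite ltnn.
Qed.

Lemma holder_le b L L' f : L <= L' -> holder b L f -> holder b L' f.
Proof.
move=> LL hf t t'; apply: (le_trans (hf t t')).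
by rewrite ler_wpM2r ?powR_ge0.
Qed.

Lemma bounded_derivative_lipschitz f f' (C : R) :
  (forall t : R, is_derive t (1 : R) f (f' t)) -> (forall t, `|f' t| <= C) ->
  forall t t', `|f t - f t'| <= C * `|t - t'|.
Proof.
move=> df f'C.
have cf : continuous f.
  move=> t; apply: differentiable_continuous; apply/derivable1_diffP.
  by have [] := df t.
have lt_case t t' : t < t' -> `|f t' - f t| <= C * `|t' - t|.
  move=> tt'.
  have dft x : x \in `]t, t'[ -> is_derive x (1 : R) f (f' x) by move=> _.
  have [|z _ ->] := MVT tt' dft; first exact: continuous_subspaceT.
  by rewrite normrM ler_wpM2r.
move=> t t'; have [tt'|tt'|->] := ltgtP t t'.
- by rewrite distrC (distrC t); exact: lt_case.
- exact: lt_case.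
by rewrite !subrr !normr0 mulr0.
Qed.

(** For d = |t - t'| <= 1 the Lipschitz bound suffices because d <= d^b; for d > 1 the sup bound
    does, because 1 <= d^b. *)
Lemma bounded_lipschitz_holder b f f' (C : R) : 0 < b <= 1 ->
  (forall t : R, is_derive t (1 : R) f (f' t)) ->
  (forall t, `|f t| <= C) -> (forall t, `|f' t| <= C) ->
  holder b (2 * C) f.
Proof.
move=> /andP[b0 b1] df fC f'C t t'.
have C0 : 0 <= C by exact: le_trans (fC 0).
have [d1|d1] := leP `|t - t'| 1.
  apply: (le_trans (bounded_derivative_lipschitz df f'C t t')).
  have dd : `|t - t'| <= `|t - t'| `^ b.
    have [->|d0] := eqVneq `|t - t'| 0; first exact: powR_ge0.
    by apply: ger1_powR => //; rewrite lt0r d0 normr_ge0.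
  have := powR_ge0 `|t - t'| b.
  nra.
apply: (@le_trans _ _ (2 * C)).
  by apply: (le_trans (ler_normB _ _)); have := fC t; have := fC t'; lra.
rewrite -[leLHS]mulr1 ler_wpM2l ?mulr_ge0//.
apply: (@le_trans _ _ (1 `^ b)); first by rewrite powR1.
by apply: ge0_ler_powR; rewrite ?nnegrE//; exact: ltW.
Qed.

End chains.

(** * A compactly supported bump *)

Section parab_bump.
Context (R : realType).

(** A quadratic error bound settles differentiability of the squared positive part by cases on signs
    alone, the kink at 0 included. *)
Lemma is_derive_quadratic_error (f : R -> R) (t d C : R) :
  (forall h : R, `|f (t + h) - f t - h * d| <= C * h ^+ 2) ->
  is_derive t (1 : R) f d.
Proof.
move=> err.
have C0 : 0 <= C by have := le_trans (normr_ge0 _) (err 1); rewrite expr1n mulr1.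
have lim : h^-1 *: (f (h *: (1 : R) + t) - f t) @[h --> (0 : R)^'] --> d.
  apply/cvgrPdist_le => e e0.
  have eC : 0 < e / (C + 1) by rewrite divr_gt0// ltr_wpDl.
  near=> h.
  have h0 : h != 0 by near: h; exact: nbhs_dnbhs_neq.
  have hs : `|h| < e / (C + 1).
    by near: h; apply: dnbhs0_lt.
  have -> : d - h^-1 *: (f (h *: (1 : R) + t) - f t) =
      - (h^-1 * (f (t + h) - f t - h * d)).
    rewrite /GRing.scale/= mulr1 (addrC h t); field.
    exact: h0.
  rewrite normrN normrM normfV ler_pdivrMl ?normr_gt0//.
  apply: (le_trans (err h)).
  rewrite -real_normK ?num_real// expr2 mulrA [leRHS]mulrC ler_wpM2r//.
  move: hs; rewrite ltr_pdivlMr; last by rewrite ltr_wpDl.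
  by have := normr_ge0 h; nra.
by apply: DeriveDef; [apply/cvg_ex; exists d|exact: cvg_lim].
Unshelve. all: by end_near. Qed.

Definition pospart (s : R) : R := Num.max 0 s.

Lemma pospart_ge0 s : 0 <= pospart s.
Proof. by rewrite /pospart le_max lexx. Qed.

Lemma mul_pospartX s n : s * pospart s ^+ n.+1 = pospart s ^+ n.+2.
Proof.
rewrite /pospart; case: (leP 0 s) => s0; first by rewrite -exprS.
by rewrite !expr0n mulr0.
Qed.

Lemma is_derive_pospart2 s :
  is_derive s (1 : R) (fun s => pospart s ^+ 2) (2 * pospart s).
Proof.
apply: (@is_derive_quadratic_error _ _ _ 1) => h; rewrite mul1r /pospart ler_norml.
by case: (leP 0 s) => s0; case: (leP 0 (s + h)) => sh; apply/andP; split; nra.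
Qed.

Lemma is_derive_pospartX n s :
  is_derive s (1 : R) (fun s => pospart s ^+ n.+2) (n.+2%:R * pospart s ^+ n.+1).
Proof.
elim: n s => [|n IH] s; first by rewrite expr1; exact: is_derive_pospart2.
have -> : (fun s => pospart s ^+ n.+3) = (fun s : R => s * pospart s ^+ n.+2).
  by apply/funext => u; rewrite mul_pospartX.
have d1 := IH s.
have d2 := is_deriveM (is_derive_id s (1 : R)) d1.
apply: (is_derive_eq d2).
rewrite /GRing.scale/= mulr1 mulrCA mul_pospartX -[n.+3%:R]natr1.
by rewrite [RHS]mulrDl mul1r.
Qed.

Definition parab_pos (t : R) : R := pospart (1 - t ^+ 2).

Lemma is_derive_parab_posX n t :
  is_derive t (1 : R) (fun t => parab_pos t ^+ n.+2)
    (- (2 * n.+2%:R * t) * parab_pos t ^+ n.+1).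
Proof.
have dp : is_derive t (1 : R) (fun t : R => 1 - t ^+ 2) (- (2 * t)).
  pose p : {poly R} := 1 - 'X^2.
  have -> : (fun t : R => 1 - t ^+ 2) = horner p.
    by apply/funext => s; rewrite hornerD hornerN hornerXn hornerC.
  apply: is_derive_eq.
  rewrite derivB derivC derivXn hornerD hornerN hornerMn hornerXn hornerC.
  by rewrite /= expr1; ring.
have h := @is_derive1_comp _ (fun s : R => pospart s ^+ n.+2) (fun t : R => 1 - t ^+ 2)
  t _ _ (is_derive_pospartX n _) dp.
by apply: (is_derive_eq h); rewrite /parab_pos; ring.
Qed.

Lemma parab_pos_le1 t : 0 <= parab_pos t <= 1.
Proof.
rewrite pospart_ge0/= /parab_pos /pospart; case: (leP 0 (1 - t ^+ 2)) => _ //.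
by rewrite gerBl sqr_ge0.
Qed.

Lemma parab_pos_eq0 t : 1 <= `|t| -> parab_pos t = 0.
Proof.
move=> t1; rewrite /parab_pos /pospart; case: (leP 0 (1 - t ^+ 2)) => // h; apply/eqP.
by rewrite eq_le h andbT subr_le0 -real_normK ?num_real// expr_ge1.
Qed.

(* parab_bump N m j is the j-th derivative of (1 - t^2)_+^N t^m / m!, for
   j + 2 <= N; the factor t^m / m! makes the m-th derivative equal to 1 at 0. *)
Fixpoint bump_poly (N m j : nat) : {poly R} :=
  if j is j'.+1 then
    (bump_poly N m j')^`() * (1 - 'X^2)
      - (2 * (N - j')%:R) *: ('X * bump_poly N m j')
  else (m`!%:R)^-1 *: 'X^m.

Definition parab_bump (N m j : nat) (t : R) : R :=
  (bump_poly N m j).[t] * parab_pos t ^+ (N - j).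

(** Each differentiation lowers the exponent of [parab_pos] by one; starting from N + 2 keeps it at
    least 2 through all N steps. *)
Lemma bump_chain N m : deriv_chain N (parab_bump N.+2 m).
Proof.
move=> j jN t; rewrite /parab_bump.
have [n En] : exists n, (N.+2 - j = n.+3)%N by exists (N - j.+1)%N; lia.
have En1 : (N.+2 - j.+1 = n.+2)%N by lia.
rewrite En En1.
have d1 := is_derive_parab_posX n.+1 t.
have d2 := is_derive_poly (bump_poly N.+2 m j) t.
have d3 := is_deriveM d2 d1.
apply: (is_derive_eq d3).
rewrite /= En /GRing.scale/= hornerD hornerN hornerZ !hornerM hornerX.
rewrite hornerD hornerN hornerXn hornerC.
have -> : parab_pos t ^+ n.+3 = (1 - t ^+ 2) * parab_pos t ^+ n.+2.
  by rewrite /parab_pos mul_pospartX.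
by ring.
Qed.

(** Lowest-order term at 0: the factor (1 - t^2)^N is 1 up to second order there, so differentiation
    acts on t^m / m! to leading order. At j = m this leaves the value 1 at the origin. *)
Lemma bump_poly_low N m j : (j <= m)%N -> exists S : {poly R},
  bump_poly N m j = ((m - j)`!%:R)^-1 *: 'X^(m - j) + 'X^((m - j).+1) * S.
Proof.
elim: j => [|j IH] jm; first by exists 0; rewrite mulr0 addr0 subn0.
have [S ES] := IH (ltnW jm).
have [k Ek] : exists k, (m - j = k.+1)%N by exists (m - j.+1)%N; lia.
have Ek1 : (m - j.+1 = k)%N by lia.
rewrite Ek1 /= ES Ek.
have fk : (k.+1`!%:R)^-1 * k.+1%:R = (k`!%:R)^-1 :> R.
  by rewrite factS natrM invfM mulrC mulrA mulfV ?mul1r ?pnatr_eq0.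
pose f := ((k.+1`!%:R)^-1)%:P : {poly R}; pose c := (2 * (N - j)%:R)%:P : {poly R}.
exists (- (f * k.+1%:R * 'X) + (k.+2%:R * S + 'X * S^`()) * (1 - 'X * 'X)
  - c * (f * 'X + 'X * 'X * S)).
have dX n : ('X^(n.+1))^`() = 'X^n * n.+1%:R :> {poly R}.
  by rewrite derivXn [RHS]mulr_natr.
have fkP : ((k`!%:R)^-1)%:P = f * k.+1%:R :> {poly R}.
  by rewrite -fk polyCM polyC_natr.
rewrite derivD derivZ derivM !dX -!mul_polyC fkP -/f -/c expr2.
rewrite ['X^(k.+2)]exprS ['X^(k.+1)]exprS.
(* The identity is proved in an abstract commutative ring, with the power X^k and the numerals k +
   1, k + 2 as free variables [Y], [K], [K']. *)
have ring_id (A : comPzRingType) (X Y u v w g K K' : A) :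
    (g * (Y * K) + (X * Y * K' * u + X * (X * Y) * v)) * (1 - X * X)
      - w * (X * (g * (X * Y) + X * (X * Y) * u)) =
    g * K * Y + X * Y * (- (g * K * X) + (K' * u + X * v) * (1 - X * X)
      - w * (g * X + X * X * u)) by ring.
exact: ring_id.
Qed.

Lemma bump_peak N m : parab_bump N m m 0 = 1.
Proof.
have [S] := bump_poly_low N (leqnn m); rewrite /parab_bump => ->.
rewrite subnn fact0 invr1 scale1r expr0 hornerD hornerM hornerXn expr1 mul0r addr0.
by rewrite hornerC mul1r /parab_pos expr0n subr0 /pospart max_r ?ler01 ?expr1n.
Qed.

Lemma bump_eq0 N m j t : (j < N)%N -> 1 <= `|t| -> parab_bump N m j t = 0.
Proof.
move=> jN t1; rewrite /parab_bump parab_pos_eq0// expr0n.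
by rewrite subn_eq0 leqNgt jN mulr0.
Qed.

Lemma bump_bounded N m j : (j < N)%N ->
  exists C, forall t, `|parab_bump N m j t| <= C.
Proof.
move=> jN; set p := bump_poly N m j.
have S0 : 0 <= \sum_(i < size p) `|p`_i| by apply: sumr_ge0.
exists (\sum_(i < size p) `|p`_i|) => t.
have [t1|t1] := leP 1 `|t|; first by rewrite bump_eq0// normr0.
have /andP[u0 u1] := parab_pos_le1 t.
rewrite normrM -[leRHS]mulr1 ler_pM//; last first.
  by rewrite ger0_norm ?exprn_ge0// exprn_ile1.
rewrite horner_coef; apply: (le_trans (ler_norm_sum _ _ _)).
apply: ler_sum => i _; rewrite normrM normrX -[leRHS]mulr1 ler_wpM2l//.
by rewrite exprn_ile1// ltW.
Qed.

End parab_bump.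

(** * A smooth density with tail of order |t|^(-q) *)

Lemma powRN_le (R : realType) (p e t : R) : 0 < p -> 0 < e ->
  e `^ (- p^-1) <= t -> t `^ (- p) <= e.
Proof.
move=> p0 e0 et.
have t0 : 0 < t by apply: lt_le_trans et; exact: powR_gt0.
rewrite powRN invf_ple ?posrE ?powR_gt0//.
have -> : e^-1 = (e `^ (- p^-1)) `^ p.
  by rewrite -powRrM mulNr mulVf ?gt_eqF// powR_inv1// ltW.
by apply: ge0_ler_powR => //; rewrite ?nnegrE ?powR_ge0// ltW.
Qed.

Section heavy_tail.
Context (R : realType).
Local Notation mu := (@lebesgue_measure R).
Variables (c q : R).
Hypotheses (c0 : 0 < c) (q1 : 1 < q).

Definition quad_poly : {poly R} := 1 + (c ^+ 2) *: 'X^2.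
Local Notation V := quad_poly.

Lemma quad_polyE t : V.[t] = 1 + (c * t) ^+ 2.
Proof. by rewrite /V hornerD hornerC hornerZ hornerXn exprMn. Qed.

Lemma quad_poly_ge1 t : 1 <= V.[t].
Proof. by rewrite quad_polyE lerDl sqr_ge0. Qed.

Lemma quad_poly_gt0 t : 0 < V.[t].
Proof. exact: lt_le_trans (quad_poly_ge1 t). Qed.

(* tail_fun j is the j-th derivative of (1 + (c t)^2)^(-q/2). *)
Fixpoint tail_poly (j : nat) : {poly R} :=
  if j is j'.+1 then
    (tail_poly j')^`() * V + (- (q / 2) - j'%:R) *: (V^`() * tail_poly j')
  else 1.

Definition tail_fun (j : nat) (t : R) : R :=
  (tail_poly j).[t] * V.[t] `^ (- (q / 2) - j%:R).

Lemma tail_fun0E t : tail_fun 0 t = V.[t] `^ (- (q / 2)).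
Proof. by rewrite /tail_fun /= hornerC mul1r subr0. Qed.

Lemma tail_fun_chain k : deriv_chain k tail_fun.
Proof.
move=> j _ t; rewrite /tail_fun.
set s := - (q / 2) - j%:R.
have d1 := is_derive_poly (tail_poly j) t.
have d2 := @is_derive1_comp _ (@powR R ^~ s) (horner V) t _ _
  (is_derive1_powR s (quad_poly_gt0 t)) (is_derive_poly V t).
have d3 := is_deriveM d1 d2.
apply: (is_derive_eq d3).
have Es : - (q / 2) - j.+1%:R = s - 1 by rewrite /s -natr1; ring.
have EP : (tail_poly j.+1).[t] =
    (tail_poly j)^`().[t] * V.[t] + s * (V^`().[t] * (tail_poly j).[t]).
  rewrite [tail_poly j.+1]/= -/s [LHS]hornerD [X in X + _]hornerM.
  by rewrite [X in _ + X]hornerZ [X in _ + _ * X]hornerM.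
have VS : V.[t] `^ s = V.[t] * V.[t] `^ (s - 1).
  rewrite -[X in X * _](powRr1 (ltW (quad_poly_gt0 t))) -powRD; last first.
    by rewrite (gt_eqF (quad_poly_gt0 t)) implybT.
  by rewrite addrC subrK.
rewrite EP Es /GRing.scale/= VS.
set W := V.[t]; set W' := V^`().[t].
by ring.
Qed.

Lemma size_deriv_le (p : {poly R}) : (size p^`()%R <= (size p).-1)%N.
Proof.
apply/leq_sizeP => j pj; rewrite coef_deriv nth_default ?mul0rn//.
by move: pj; case: (size p).
Qed.

Lemma size_tail_poly j : (size (tail_poly j) <= j.+1)%N.
Proof.
have sV : (size V <= 3)%N.
  rewrite (leq_trans (size_polyD _ _))// geq_max size_poly1/=.
  by rewrite (leq_trans (size_scale_leq _ _))// size_polyXn.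
have sV' : (size V^`() <= 2)%N by have := size_deriv_le V; lia.
elim: j => [|j IH]; first by rewrite /= size_poly1.
have sd := size_deriv_le (tail_poly j).
rewrite /= (leq_trans (size_polyD _ _))// geq_max; apply/andP; split.
  apply: (leq_trans (size_mul_leq _ _)); lia.
apply: (leq_trans (size_scale_leq _ _)).
apply: (leq_trans (size_mul_leq _ _)); lia.
Qed.

(** The crude bound |t| <= (1 + 1/c) V(t) is enough, because the j-th derivative of the tail
    function carries an extra factor V^(-j). *)
Lemma poly_le_quad (p : {poly R}) j : (size p <= j.+1)%N ->
  exists2 C, 0 <= C & forall t, `|p.[t]| <= C * V.[t] ^+ j.
Proof.
have c_gt0 := c0; have q_gt1 := q1.
move=> sp; pose K := 1 + c^-1.
have ci0 : 0 < c^-1 by rewrite invr_gt0.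
have KV1 t : 1 <= K * V.[t] by have := quad_poly_ge1 t; rewrite /K; nra.
have KVt t : `|t| <= K * V.[t].
  have -> : `|t| = c^-1 * `|c * t|.
    by rewrite normrM (gtr0_norm c0) mulrA mulVf ?mul1r// gt_eqF.
  have Vb := quad_poly_ge1 t.
  have : `|c * t| <= V.[t].
    rewrite quad_polyE -(real_normK (num_real (c * t))).
    by have := normr_ge0 (c * t); nra.
  rewrite /K; have := normr_ge0 (c * t); nra.
exists ((\sum_(i < size p) `|p`_i|) * K ^+ j).
  rewrite mulr_ge0 ?sumr_ge0// exprn_ge0// /K; lra.
move=> t; rewrite horner_coef; apply: (le_trans (ler_norm_sum _ _ _)).
rewrite -mulrA -exprMn mulr_suml; apply: ler_sum => i _.
rewrite normrM normrX ler_wpM2l//.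
apply: (@le_trans _ _ ((K * V.[t]) ^+ i)).
  by rewrite lerXn2r ?nnegrE// (le_trans _ (KV1 t)).
rewrite ler_weXn2l//; have := ltn_ord i; lia.
Qed.

Lemma tail_fun_bounded j : exists C, forall t, `|tail_fun j t| <= C.
Proof.
have c_gt0 := c0; have q_gt1 := q1.
have [C C0 HC] := poly_le_quad (size_tail_poly j).
exists C => t; rewrite normrM (ger0_norm (powR_ge0 _ _)).
have V0 := quad_poly_gt0 t; have V1 := quad_poly_ge1 t.
apply: (@le_trans _ _ (C * V.[t] ^+ j * V.[t] `^ (- j%:R))).
  apply: ler_pM => //; first exact: powR_ge0.
  apply: ler_powR => //.
  lra.
by rewrite (powR_invn j (ltW V0)) -mulrA divff ?mulr1 ?expf_neq0 ?gt_eqF.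
Qed.

Lemma tail_fun0_gt0 t : 0 < tail_fun 0 t.
Proof. by rewrite tail_fun0E powR_gt0// quad_poly_gt0. Qed.

Lemma quad_poly_le t : V.[t] <= ((1 + c) * (1 + `|t|)) ^+ 2.
Proof.
have c_gt0 := c0; have q_gt1 := q1.
rewrite quad_polyE [(c * t) ^+ 2]exprMn -(real_normK (num_real t)) -exprMn.
set u := `|t|; have u0 : 0 <= u by exact: normr_ge0.
have -> : (1 + c) * (1 + u) = 1 + c * u + (c + u) by ring.
have cu0 : 0 <= c * u by rewrite mulr_ge0// ltW.
have cu : 0 <= c + u by lra.
nra.
Qed.

Lemma quad_poly_ge t : (c / (1 + c) * (1 + `|t|)) ^+ 2 <= 2 * V.[t].
Proof.
have c_gt0 := c0; have q_gt1 := q1.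
rewrite quad_polyE [(c * t) ^+ 2]exprMn -(real_normK (num_real t)).
set u := `|t|; have u0 : 0 <= u by exact: normr_ge0.
have -> : (c / (1 + c) * (1 + u)) ^+ 2 = (c * (1 + u)) ^+ 2 / (1 + c) ^+ 2.
  by field; rewrite gt_eqF//; lra.
rewrite ler_pdivrMr ?exprn_gt0//; last lra.
rewrite -subr_ge0.
have -> : 2 * (1 + c ^+ 2 * u ^+ 2) * (1 + c) ^+ 2 - (c * (1 + u)) ^+ 2 =
  2 + 4 * c + c ^+ 2 * ((1 - u) ^+ 2)
   + 4 * c ^+ 2 * u ^+ 2 * c + 2 * (c ^+ 2 * u ^+ 2 * c ^+ 2) by ring.
have c2 : 0 <= c ^+ 2 by exact: sqr_ge0.
have u2 : 0 <= u ^+ 2 by exact: sqr_ge0.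
have a1 : 0 <= c ^+ 2 * ((1 - u) ^+ 2) by exact: mulr_ge0 (sqr_ge0 _).
have a2 : 0 <= c ^+ 2 * u ^+ 2 by exact: mulr_ge0.
have a3 : 0 <= c ^+ 2 * u ^+ 2 * c by exact: mulr_ge0 (ltW c0).
have a4 : 0 <= c ^+ 2 * u ^+ 2 * c ^+ 2 by exact: mulr_ge0.
lra.
Qed.

Lemma powR_sqr_half (x : R) : 0 <= x -> (x ^+ 2) `^ (q / 2) = x `^ q.
Proof.
move=> x0; rewrite -powR_mulrn// -powRrM; congr (_ `^ _).
by rewrite mulrC divfK ?pnatr_eq0.
Qed.

Lemma tail_fun_lower t : ((1 + c) `^ q)^-1 / (1 + `|t|) `^ q <= tail_fun 0 t.
Proof.
have c_gt0 := c0; have q_gt1 := q1.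
have t1 : 0 < 1 + `|t| by rewrite ltr_pwDl.
rewrite tail_fun0E powRN -invfM -powRM; [|lra|exact: ltW].
rewrite lef_pV2 ?posrE ?powR_gt0 ?quad_poly_gt0//; last by rewrite mulr_gt0//; lra.
rewrite -[leRHS]powR_sqr_half; last by rewrite mulr_ge0//; lra.
apply: ge0_ler_powR;
  rewrite ?nnegrE ?quad_poly_le ?sqr_ge0 ?(ltW (quad_poly_gt0 _))//.
by rewrite divr_ge0//; lra.
Qed.

Lemma tail_fun_upper t : t != 0 -> tail_fun 0 t <= c `^ (- q) * `|t| `^ (- q).
Proof.
have c_gt0 := c0; have q_gt1 := q1.
move=> t0; have tt : 0 < `|t| by rewrite normr_gt0.
rewrite tail_fun0E !powRN -invfM -powRM; [|exact: ltW|exact: ltW].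
rewrite lef_pV2 ?posrE ?powR_gt0 ?quad_poly_gt0 ?mulr_gt0//.
rewrite -[leLHS]powR_sqr_half; last by rewrite mulr_ge0// ltW.
apply: ge0_ler_powR; rewrite ?nnegrE ?sqr_ge0 ?(ltW (quad_poly_gt0 _))//.
  by rewrite divr_ge0//; lra.
rewrite quad_polyE -(real_normK (num_real (c * t))) normrM (gtr0_norm c0).
by rewrite lerDr.
Qed.

Lemma continuous_tail_fun j : continuous (tail_fun j).
Proof.
move=> t; apply: differentiable_continuous; apply/derivable1_diffP.
by have [] := tail_fun_chain (ltnSn j) t.
Qed.

(** By symmetry only the half-line matters; there the function is below k (1 + t)^(-q), whose
    antiderivative [H] vanishes at infinity because q > 1. *)
Lemma integral_tail_fun_lty : (\int[mu]_t (tail_fun 0 t)%:E < +oo)%E.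
Proof.
have c_gt0 := c0; have q_gt1 := q1.
have gpos t : 0 <= tail_fun 0 t by exact: ltW (tail_fun0_gt0 t).
rewrite ge0_symfun_integralT//; [|exact: continuous_tail_fun|]; last first.
  by move=> t /=; rewrite !tail_fun0E !quad_polyE mulrN sqrrN.
rewrite lte_mul_pinfty//; rewrite -set_itvcy.
pose k := (2 `^ (q / 2)) / (c / (1 + c)) `^ q.
pose H (t : R) : R := - (k / (q - 1)) * (1 + t) `^ (1 - q).
pose h (t : R) := k * (1 + t) `^ (- q).
have cc : 0 < c / (1 + c) by rewrite divr_gt0//; lra.
have k0 : 0 < k by rewrite divr_gt0 ?powR_gt0.
have upper (t : R) : 0 <= t -> tail_fun 0 t <= h t.
  move=> t0; rewrite tail_fun0E /h /k powRN [(1 + t) `^ _]powRN.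
  have ct : 0 <= c / (1 + c) * (1 + t) by rewrite mulr_ge0 ?ltW//; lra.
  rewrite -mulrA -invfM -powRM; [|exact: ltW|lra].
  rewrite ler_pdivlMr; last by rewrite powR_gt0// mulr_gt0//; lra.
  rewrite mulrC ler_pdivrMr ?powR_gt0 ?quad_poly_gt0//.
  rewrite -powRM//; last exact: ltW (quad_poly_gt0 _).
  rewrite -powR_sqr_half//.
  have := quad_poly_ge t; rewrite ger0_norm// => Vt.
  apply: ge0_ler_powR => //; rewrite ?nnegrE ?sqr_ge0//; first lra.
  by rewrite mulr_ge0// ltW// quad_poly_gt0.
have dshift t : is_derive t (1 : R) (fun t : R => 1 + t) (1 : R).
  have d := is_deriveD (is_derive_cst (1 : R) t (1 : R)) (is_derive_id t (1 : R)).
  exact: (is_derive_eq d (add0r _)).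
have dH (t : R) : 0 <= t -> is_derive t (1 : R) H (h t).
  move=> t0; have t1 : 0 < 1 + t by lra.
  have d1 := @is_derive1_comp _ (@powR R ^~ (1 - q)) (fun t : R => 1 + t) t _ _
    (is_derive1_powR (1 - q) t1) (dshift t).
  have d2 := is_deriveZ (- (k / (q - 1))) d1.
  apply: (is_derive_eq d2); rewrite /h mulr1 /GRing.scale/=.
  have -> : 1 - q - 1 = - q by ring.
  by field; rewrite gt_eqF//; lra.
have ch (t : R) : 0 <= t -> {for t, continuous h}.
  move=> t0; have t1 : 0 < 1 + t by lra.
  have d1 := @is_derive1_comp _ (@powR R ^~ (- q)) (fun t : R => 1 + t) t _ _
    (is_derive1_powR (- q) t1) (dshift t).
  have d2 := is_deriveZ k d1.
  apply: differentiable_continuous; apply/derivable1_diffP.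
  by have [] := d2.
have h0 (t : R) : 0 <= t -> 0 <= h t by move=> t0; rewrite /h mulr_ge0 ?powR_ge0 ?ltW.
have contH (t : R) : 0 <= t -> {for t, continuous H}.
  move=> t0; apply: differentiable_continuous; apply/derivable1_diffP.
  by have [] := dH t t0.
have cwh : {within `[0, +oo[, continuous h}.
  apply/continuous_within_itvcyP; split.
    by move=> x; rewrite in_itv/= andbT => x0; exact: ch (ltW x0).
  by apply: cvg_at_right_filter; exact: ch.
have limH : H x @[x --> +oo%R] --> 0.
  apply/cvgrPdist_le => e e0.
  have q1' : 0 < q - 1 by lra.
  have e' : 0 < e / (k / (q - 1)) by rewrite divr_gt0// divr_gt0.
  near=> x.
  have xbig : (e / (k / (q - 1))) `^ (- (q - 1)^-1) <= 1 + x.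
    apply: (@le_trans _ _ x); last by rewrite lerDr.
    by near: x; exact: nbhs_pinfty_ge.
  have := powRN_le q1' e' xbig.
  rewrite opprB sub0r normrN /H normrM normrN (gtr0_norm (divr_gt0 k0 q1')).
  rewrite (ger0_norm (powR_ge0 _ _)) ler_pdivlMr; last exact: divr_gt0.
  by rewrite mulrC.
have Ih : (\int[mu]_(x in `[0%R, +oo[) (h x)%:E = 0%:E - (H 0)%:E)%E.
  have dH' (x : R) : 0 < x -> derivable H x 1 by move=> x0; have [] := dH x (ltW x0).
  have H0 : H x @[x --> 0^'+] --> H 0.
    by apply: cvg_at_right_filter; exact: contH.
  have Hh : {in `]0, +oo[, derive1 H =1 h}.
    move=> x; rewrite in_itv/= andbT => x0; rewrite derive1E.
    by have [_ ->] := dH x (ltW x0).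
  exact: (ge0_continuous_FTC2y h0 cwh limH dH' H0 Hh).
apply: (@le_lt_trans _ _ (\int[mu]_(x in `[0%R, +oo[) (h x)%:E)%E); last first.
  by rewrite Ih -EFinB ltry.
have mT : measurable_fun [set: measurableTypeR R] (fun t => (tail_fun 0 t)%:E).
  apply/measurable_EFinP; apply: continuous_measurable_fun; exact: continuous_tail_fun.
apply: ge0_le_integral => //.
- by move=> x _; rewrite lee_fin; exact: gpos.
- exact: measurable_funTS.
- apply/measurable_funTS/measurable_EFinP; apply: measurable_funM => //.
  apply: (measurableT_comp (measurable_powR _)); exact: measurable_funD.
- by move=> x; rewrite /= in_itv/= andbT => x0; rewrite lee_fin upper.
Unshelve. all: by end_near. Qed.

(** On [-1/c, 1/c] the quadratic 1 + (c t)^2 is at most 2. A mass of order at least 1/c makes the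
    tail constant after normalization at most of order c^(1-q), hence small for large c. *)
Lemma integral_tail_fun_ge :
  ((2 * c^-1 / 2 `^ (q / 2))%:E <= \int[mu]_t (tail_fun 0 t)%:E)%E.
Proof.
have c_gt0 := c0; have q_gt1 := q1.
have ci : 0 < c^-1 by rewrite invr_gt0.
have mT : measurable_fun [set: measurableTypeR R] (fun t => (tail_fun 0 t)%:E).
  apply/measurable_EFinP; apply: continuous_measurable_fun; exact: continuous_tail_fun.
have gpos t : (0 <= (tail_fun 0 t)%:E)%E by rewrite lee_fin ltW ?tail_fun0_gt0.
pose D : set (measurableTypeR R) := `[(- c^-1)%R, c^-1%R]%classic.
have mD : measurable D by exact: measurable_itv.
apply: (@le_trans _ _ (\int[mu]_(t in D) (tail_fun 0 t)%:E)%E); last first.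
  exact: ge0_subset_integral.
apply: (@le_trans _ _ (\int[mu]_(t in D) ((2 `^ (q / 2))^-1)%:E)%E).
  rewrite integral_cst//= /D lebesgue_measure_itv/= lte_fin gtrN// -EFinB -EFinM lee_fin.
  by rewrite le_eqVlt; apply/orP; left; apply/eqP; ring.
apply: ge0_le_integral => //.
- exact: measurable_funTS.
move=> t; rewrite /D/= in_itv/= -ler_norml => tc.
rewrite lee_fin tail_fun0E powRN lef_pV2 ?posrE ?powR_gt0 ?quad_poly_gt0//.
apply: ge0_ler_powR; rewrite ?nnegrE ?(ltW (quad_poly_gt0 _))//.
  by rewrite divr_ge0//; lra.
rewrite quad_polyE [(c * t) ^+ 2]exprMn -(real_normK (num_real t)) -exprMn.
have : c * `|t| <= 1 by rewrite -(@mulfV _ c) ?gt_eqF// ler_pM2l.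
have : 0 <= c * `|t| by rewrite mulr_ge0// ltW.
by nra.
Qed.

End heavy_tail.

(** * Mixtures, perturbations and the null density *)

Section densities.
Context (R : realType).
Local Notation mu := (@lebesgue_measure R).

Lemma pdf_integrable (f : density R) : mu.-integrable setT (EFin \o f).
Proof.
apply/integrableP; split.
  by apply/measurable_EFinP; exact: measurable_pdf.
under eq_integral do rewrite /= ger0_norm ?pdf_ge0//.
by rewrite integral_pdf ltry.
Qed.

Lemma exists_density (g : R -> R) :
  measurable_fun [set: measurableTypeR R] g -> (forall t, 0 <= g t) ->
  (\int[mu]_t (g t)%:E = 1)%E -> exists f : density R, f = g :> (R -> R).
Proof. by move=> mg g0 g1; exists (Density mg g0 g1). Qed.

Lemma mix_density (f p : density R) (e : R) : 0 <= e <= 1 ->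
  exists g : density R, g = (fun t => (1 - e) * f t + e * p t) :> (R -> R).
Proof.
move=> /andP[e0 e1]; apply: exists_density.
- apply: measurable_funD; apply: measurable_funM => //; exact: measurable_pdf.
- by move=> t; rewrite addr_ge0// mulr_ge0 ?pdf_ge0 ?subr_ge0.
under eq_integral do rewrite EFinD !EFinM.
have mf (h : density R) : measurable_fun [set: measurableTypeR R] (fun t => (h t)%:E).
  by apply/measurable_EFinP; exact: measurable_pdf.
have h0 (h : density R) t : (0 <= (h t)%:E)%E by rewrite lee_fin pdf_ge0.
have e1' : 0 <= 1 - e by rewrite subr_ge0.
rewrite ge0_integralD//; last 4 first.
- by move=> t _; rewrite mule_ge0.
- exact: emeasurable_funM.
- by move=> t _; rewrite mule_ge0.
- exact: emeasurable_funM.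
rewrite !ge0_integralZl_EFin// !integral_pdf !mule1 -EFinD.
by rewrite subrK.
Qed.

Lemma compact_support_integral (F f : R -> R) (K : R) : 0 < K ->
  (forall t : R, is_derive t (1 : R) F (f t)) -> continuous f ->
  (forall t, K <= `|t| -> f t = 0) -> (forall t, K <= `|t| -> F t = 0) ->
  mu.-integrable setT (EFin \o f) /\ (\int[mu]_t (f t)%:E = 0)%E.
Proof.
move=> K0 dF cf f0 F0.
have KK : - K < K by exact: gtrN.
pose D : set (measurableTypeR R) := `[- K, K]%classic.
have mD : measurable D by exact: measurable_itv.
have fE : EFin \o f = (EFin \o f) \_ D.
  apply/funext => t; rewrite patchE; case: ifPn => //=.
  rewrite notin_setE /D/= in_itv/= -ler_norml => /negP; rewrite -ltNge => Kt.
  by rewrite f0// ltW.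
have fD : mu.-integrable D (EFin \o f).
  apply: continuous_compact_integrable; first exact: segment_compact.
  exact: continuous_subspaceT.
split.
  rewrite fE.
  exact: (@integrable_mkcond _ (measurableTypeR R) R mu D (EFin \o f) mD).1.
transitivity (\int[mu]_(t in D) (f t)%:E)%E.
  by rewrite [RHS]integral_mkcond; congr (integral _ _ _).
have cF := is_derive_continuous dF.
rewrite /D (@continuous_FTC2 _ f F)//.
- by rewrite !F0 ?normrN ?(gtr0_norm K0)// -EFinB subrr.
- exact: continuous_subspaceT.
- split.
  + by move=> x _; have [] := dF x.
  + by apply: cvg_at_right_filter; exact: cF.
  + by apply: cvg_at_left_filter; exact: cF.
- by move=> x _; rewrite derive1E; have [_ ->] := dF x.
Qed.

(** Total mass is preserved because the perturbation is the derivative of a compactly supported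
    function. *)
Lemma perturb_density (f : density R) (F psi : R -> R) (K : R) : 0 < K ->
  (forall t : R, is_derive t (1 : R) F (psi t)) -> continuous psi ->
  (forall t, K <= `|t| -> psi t = 0) -> (forall t, K <= `|t| -> F t = 0) ->
  (forall t, 0 <= f t + psi t) ->
  exists g : density R, g = (fun t => f t + psi t) :> (R -> R).
Proof.
move=> K0 dF cpsi psi0 F0 pos.
have [ipsi I0] := compact_support_integral K0 dF cpsi psi0 F0.
apply: exists_density => //.
- by apply: measurable_funD; [exact: measurable_pdf|exact: continuous_measurable_fun].
under eq_integral do rewrite EFinD.
by rewrite integralD//= ?integral_pdf ?I0 ?adde0//; exact: pdf_integrable.
Qed.

Lemma base_density (q B : R) : 1 < q -> 0 < B ->
  exists (p : density R) (F : nat -> R -> R) (c : R),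
  [/\ F 0%N = p, forall k, deriv_chain k F,
      forall j, exists C, forall t, `|F j t| <= C,
      forall t, t != 0 -> p t <= B / 2 * `|t| `^ (- q) &
      0 < c /\ forall t, c / (1 + `|t|) `^ q <= p t].
Proof.
move=> q1 B0.
(* The scale c solves c^(1-q) = D. Then c^(-q) = D / c is exactly B / 2 times the lower bound on the
   normalizing constant Z, so the tail constant c^(-q) / Z is at most B / 2. *)
pose D := B / 2 `^ (q / 2).
have D0 : 0 < D by rewrite divr_gt0 ?powR_gt0.
pose c := D `^ (- (q - 1)^-1).
have c0 : 0 < c by exact: powR_gt0.
have Ilt := integral_tail_fun_lty c0 q1.
have Ige := integral_tail_fun_ge c0 q1.
set I := (\int[mu]_t _)%E in Ilt Ige.
have P2 : 0 < 2 `^ (q / 2) :> R by exact: powR_gt0.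
have [Z ZE] : exists Z, I = Z%:E.
  exists (fine I); rewrite fineK// ge0_fin_numE//.
  by apply: integral_ge0 => t _; rewrite lee_fin ltW// tail_fun0_gt0.
have Zge : 2 * c^-1 / 2 `^ (q / 2) <= Z by rewrite -lee_fin -ZE.
have Z0 : 0 < Z.
  by apply: lt_le_trans Zge; rewrite divr_gt0// mulr_gt0// invr_gt0.
have [p pE] : exists p : density R, p = (fun t => Z^-1 * tail_fun c q 0 t) :> (R -> R).
  apply: exists_density.
  - apply: measurable_funM => //; apply: continuous_measurable_fun.
    exact: continuous_tail_fun.
  - by move=> t; rewrite mulr_ge0 ?invr_ge0 ?ltW// tail_fun0_gt0.
  under eq_integral do rewrite EFinM.
  rewrite ge0_integralZl_EFin//.
  - by rewrite -/I ZE -EFinM mulVf// gt_eqF.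
  - by move=> t _; rewrite lee_fin ltW// tail_fun0_gt0.
  - apply/measurable_EFinP; apply: continuous_measurable_fun.
    exact: continuous_tail_fun.
  - by rewrite invr_ge0 ltW.
exists p, (fun j t => Z^-1 * tail_fun c q j t), (Z^-1 * ((1 + c) `^ q)^-1).
split => //.
- move=> k j jk t.
  by have d := tail_fun_chain c q jk t; exact: is_deriveZ.
- move=> j; have [C HC] := tail_fun_bounded c0 q1 j.
  exists (Z^-1 * C) => t; rewrite normrM gtr0_norm ?invr_gt0//.
  by rewrite ler_wpM2l// invr_ge0 ltW.
- move=> t t0; rewrite pE.
  apply: (@le_trans _ _ (Z^-1 * (c `^ (- q) * `|t| `^ (- q)))).
    by apply: ler_wpM2l; [rewrite invr_ge0 ltW|exact: tail_fun_upper].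
  rewrite mulrA ler_wpM2r ?powR_ge0//.
  rewrite mulrC ler_pdivrMr//.
  apply: (@le_trans _ _ (B / 2 * (2 * c^-1 / 2 `^ (q / 2)))); last first.
    by rewrite ler_wpM2l// divr_ge0// ltW.
  have -> : B / 2 * (2 * c^-1 / 2 `^ (q / 2)) = D * c^-1.
    by rewrite /D; field; rewrite !gt_eqF.
  have -> : c `^ (- q) = c `^ (- (q - 1)) * c^-1.
    rewrite -(powR_inv1 (ltW c0)) -powRD ?(gt_eqF c0) ?implybT//.
    by congr (_ `^ _); ring.
  have -> : c `^ (- (q - 1)) = D.
    rewrite /c -powRrM mulrNN mulVf; first exact: powRr1 (ltW D0).
    by rewrite subr_eq0 gt_eqF.
  exact: lexx.
split; first by rewrite mulr_gt0 ?invr_gt0// powR_gt0//; lra.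
move=> t; rewrite pE -mulrA; apply: ler_wpM2l; first by rewrite invr_ge0 ltW.
exact: tail_fun_lower.
Qed.

(* Mixing a given density of the class with a little of a concentrated
   heavy-tailed one: the Hölder slack A0 - A1 pays for the smoothness of the
   latter, whose tail constant B / 2 creates the slack in the tail bound. *)
Lemma null_density (alpha q B A0 A1 : R) : 0 < alpha -> 1 < q -> 0 < B ->
  0 < A1 < A0 -> W_class alpha q A1 B !=set0 ->
  exists (f : density R) (F : nat -> R -> R) (eta delta c : R),
  [/\ F 0%N = f, deriv_chain (sfloor alpha) F & continuous (F (sfloor alpha))] /\
  [/\ 0 < eta < 1,
      holder (alpha - (sfloor alpha)%:R) (A0 * (1 - eta)) (F (sfloor alpha)),
      0 < delta,
      forall t, t != 0 -> f t <= (B - delta) * `|t| `^ (- q) &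
      0 < c /\ forall t, c / (1 + `|t|) `^ q <= f t].
Proof.
move=> a0 q1 B0 /andP[A10 A1A0] [f1 [[cd1 hold1] tail1]].
have b01 := sfloor_exponent a0.
set k := sfloor alpha in cd1 hold1 b01 *.
have [p [G [c [G0 dG bG tailp [c0 lowp]]]]] := base_density q1 B0.
have [C0 HC0] := bG k; have [C1 HC1] := bG k.+1.
pose C := Num.max C0 C1.
have CG : 0 <= C by rewrite le_max (le_trans (normr_ge0 _) (HC0 0)).
have holdp : holder (alpha - k%:R) (2 * C) (G k).
  apply: (@bounded_lipschitz_holder _ _ _ (G k.+1)) => //.
  - by move=> t; exact: dG (ltnSn k) t.
  - by move=> t; rewrite (le_trans (HC0 t))// le_max lexx.
  - by move=> t; rewrite (le_trans (HC1 t))// le_max lexx orbT.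
(* The mixing weight spends at most half of the gap A0 - A1 on the smoothness of p. This leaves the
   Hölder constant (A0 + A1) / 2 = A0 (1 - eta) for eta = (A0 - A1) / (2 A0). The added 1 keeps the
   denominator positive when C = 0. *)
pose e := Num.min 2^-1 ((A0 - A1) / (2 * (2 * C + 1))).
have A01 : 0 < A0 - A1 by rewrite subr_gt0.
have C21 : 0 < 2 * (2 * C + 1) by lra.
have e0 : 0 < e by rewrite lt_min invr_gt0 ltr0n/= divr_gt0.
have e1 : e <= 2^-1 by rewrite ge_min lexx.
have eA : e * (2 * C) <= (A0 - A1) / 2.
  have : e <= (A0 - A1) / (2 * (2 * C + 1)) by rewrite ge_min lexx orbT.
  rewrite ler_pdivlMr//; nra.
have [f fE] : exists g : density R, g = (fun t => (1 - e) * f1 t + e * p t) :> (R -> R).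
  by apply: mix_density; lra.
have dF1 := continuously_differentiable_chain cd1.
exists f, (fun j t => (1 - e) * derive1n j f1 t + e * G j t),
  ((A0 - A1) / (2 * A0)), (e * (B / 2)), (e * c).
have A00 : 0 < A0 by lra.
split; split.
- by rewrite fE derive1n0 G0.
- exact: deriv_chain_lincomb.
- apply: continuous_lincomb; first exact: cd1.2.
  by apply: (@is_derive_continuous _ _ (G k.+1)) => t; exact: dG (ltnSn k) t.
- rewrite divr_gt0 ?mulr_gt0//= ltr_pdivrMr ?mulr_gt0//; lra.
- apply: (@holder_le _ _ ((1 - e) * A1 + e * (2 * C))).
    have -> : A0 * (1 - (A0 - A1) / (2 * A0)) = (A0 + A1) / 2.
      by field; rewrite gt_eqF.
    nra.
  by apply: holder_lincomb => //; lra.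
- by rewrite mulr_gt0// divr_gt0.
- move=> t t0; rewrite fE.
  have T0 := powR_ge0 `|t| (- q).
  have h1 := tail1 t t0; have h2 := tailp t t0.
  have : (1 - e) * f1 t <= (1 - e) * (B * `|t| `^ (- q)) by rewrite ler_wpM2l//; lra.
  have : e * p t <= e * (B / 2 * `|t| `^ (- q)) by rewrite ler_wpM2l// ltW.
  lra.
split; first exact: mulr_gt0.
move=> t; rewrite fE -mulrA.
have : e * (c / (1 + `|t|) `^ q) <= e * p t by rewrite ler_wpM2l// ltW.
have : 0 <= (1 - e) * f1 t by rewrite mulr_ge0 ?pdf_ge0//; lra.
lra.
Qed.

End densities.

(** * Differences of lattice sums *)

Section lattice_cdiff.
Context (R : realType) (theta : R).

Lemma cdiff_lattice_conv (p : {poly R}) (F : R -> R) y :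
  cdiff theta (lattice_conv theta p F) y =
  (2 * theta)^-1 * lattice_conv theta ((1 - 'X) * p) F (y + theta).
Proof.
rewrite lattice_conv_mul1BX /cdiff mulrC; congr (_ * (_ - lattice_conv _ _ _ _)).
ring.
Qed.

(** All differences fall on the weights and leave F untouched. The argument moves by m theta because
    [cdiff] is centred whereas multiplication by 1 - X is a one-sided difference. *)
Lemma iter_cdiff_lattice_conv m (p : {poly R}) (F : R -> R) y :
  iter m (cdiff theta) (lattice_conv theta p F) y =
  (2 * theta) ^- m * lattice_conv theta ((1 - 'X) ^+ m * p) F (y + m%:R * theta).
Proof.
elim: m y => [|m IH] y; first by rewrite !expr0 invr1 !mul1r mul0r addr0.
have E : iter m (cdiff theta) (lattice_conv theta p F) =
  (fun y => (2 * theta) ^- m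
    * lattice_conv theta ((1 - 'X) ^+ m * p) F (y + m%:R * theta)).
  by apply/funext.
rewrite iterS E /cdiff -mulrBr.
have := cdiff_lattice_conv ((1 - 'X) ^+ m * p) F (y + m%:R * theta).
rewrite /cdiff => H.
have e1 : y + m%:R * theta + theta = y + theta + m%:R * theta by ring.
have e2 : y + m%:R * theta - theta = y - theta + m%:R * theta by ring.
have e3 : y + m.+1%:R * theta = y + m%:R * theta + theta by rewrite -natr1; ring.
have e4 : (1 - 'X) ^+ m.+1 * p = (1 - 'X) * ((1 - 'X) ^+ m * p).
  by rewrite exprS mulrA.
have e5 : (2 * theta) ^- m.+1 = (2 * theta) ^- m * (2 * theta)^-1.
  by rewrite exprSr invfM.
rewrite e3 e4 e5 -[RHS]mulrA -H e1 e2.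
by rewrite -mulrA.
Qed.

Lemma lattice_conv_chain k (p : {poly R}) (F : nat -> R -> R) :
  deriv_chain k F -> deriv_chain k (fun j => lattice_conv theta p (F j)).
Proof.
move=> dF j jk t; rewrite /lattice_conv.
pose h (i : 'I_(size p)) (t : R) := p`_i * F j (t - 2 * theta * i%:R).
have -> : (fun t => \sum_(i < size p) p`_i * F j (t - 2 * theta * i%:R)) =
    \sum_(i < size p) h i.
  by apply/funext => s; rewrite fct_sumE.
apply: is_derive_sum => i.
have d1 := is_derive_comp_addr (dF j jk (t - 2 * theta * i%:R)).
exact: (is_deriveZ _ d1).
Qed.

End lattice_cdiff.

(** * The alternative *)

Section bump_train.
Context (R : realType) (theta h s : R).
Hypotheses (h0 : 0 < h) (htheta : h <= theta).
Implicit Types (p : {poly R}) (F : R -> R).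

Lemma lattice_separated (u : R) (i j : nat) : i <> j ->
  `|u - 2 * theta * i%:R| < h -> h <= `|u - 2 * theta * j%:R|.
Proof.
have hg := h0; have hth := htheta.
move=> /eqP ij; rewrite neq_ltn in ij.
rewrite ltr_norml => /andP[u1 u2].
case/orP: ij => lt.
- have : i%:R + 1 <= j%:R :> R by rewrite natr1 ler_nat.
  move=> d; rewrite ler0_norm; nra.
- have : j%:R + 1 <= i%:R :> R by rewrite natr1 ler_nat.
  move=> d; rewrite ger0_norm; nra.
Qed.

(** Bumps of half-width h <= theta on a lattice of step 2 theta have disjoint interiors, so at most
    one is active at any point. Pointwise bounds on the train are therefore those of a single bump,
    with no loss growing with M. *)
Lemma lattice_conv_single p F (t : R) :
  (forall t, h <= `|t - s| -> F t = 0) ->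
  ((forall i, (i < size p)%N -> h <= `|t - s - 2 * theta * i%:R|) /\
    lattice_conv theta p F t = 0) \/
  (exists i, [/\ (i < size p)%N, `|t - s - 2 * theta * i%:R| < h &
    lattice_conv theta p F t = p`_i * F (t - 2 * theta * i%:R)]).
Proof.
move=> F0.
have F0' i : h <= `|t - s - 2 * theta * i%:R| -> F (t - 2 * theta * i%:R) = 0.
  by move=> hi; apply: F0; rewrite addrAC.
have [[i [ip hi]]|none] :=
    pselect (exists i, (i < size p)%N /\ `|t - s - 2 * theta * i%:R| < h).
  right; exists i; split => //; rewrite /lattice_conv (bigD1 (Ordinal ip))//=.
  rewrite big1 ?addr0// => j; rewrite -val_eqE/= => /eqP ji.
  by rewrite F0' ?mulr0//; apply: lattice_separated hi => ij; apply: ji.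
have far i : (i < size p)%N -> h <= `|t - s - 2 * theta * i%:R|.
  by move=> ip; rewrite leNgt; apply/negP => hi; apply: none; exists i.
left; split => //; rewrite /lattice_conv big1// => i _.
by rewrite F0' ?mulr0//; apply: far.
Qed.

(** The factor 2 comes from points t, t' lying in different bumps i and j: bump i vanishes at t' and
    bump j at t, so each of the two values is an increment of its own bump. *)
Lemma holder_lattice_conv p F (b L : R) :
  (forall i, 0 <= p`_i <= 1) -> (forall t, h <= `|t - s| -> F t = 0) ->
  0 <= L -> holder b L F -> holder b (2 * L) (lattice_conv theta p F).
Proof.
move=> p01 F0 L0 hF t t'.
have F0' (u : R) i : h <= `|u - s - 2 * theta * i%:R| -> F (u - 2 * theta * i%:R) = 0.
  by move=> hi; apply: F0; rewrite addrAC.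
set d := `|t - t'| `^ b; have d0 : 0 <= d by exact: powR_ge0.
have Ld : 0 <= L * d by exact: mulr_ge0.
have step i :
    `|p`_i * F (t - 2 * theta * i%:R) - p`_i * F (t' - 2 * theta * i%:R)| <= L * d.
  rewrite -mulrBr normrM; have /andP[pi0 pi1] := p01 i.
  rewrite (ger0_norm pi0).
  have := hF (t - 2 * theta * i%:R) (t' - 2 * theta * i%:R).
  have -> : t - 2 * theta * i%:R - (t' - 2 * theta * i%:R) = t - t' by ring.
  rewrite -/d; have := normr_ge0 (F (t - 2 * theta * i%:R) - F (t' - 2 * theta * i%:R)).
  nra.
have [[far ->]|[i [ip hi ->]]] := lattice_conv_single p t F0;
  have [[far' ->]|[j [jp hj ->]]] := lattice_conv_single p t' F0.
- by rewrite subrr normr0 -mulrA mulr_ge0.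
- have := step j; rewrite (F0' t j) ?mulr0; last exact: far.
  by move=> /le_trans; apply; lra.
- have := step i; rewrite (F0' t' i) ?mulr0; last exact: far'.
  by move=> /le_trans; apply; lra.
have [ij|/eqP ij] := eqVneq i j.
  by rewrite -ij; apply: (le_trans (step i)); lra.
have si := step i; rewrite (F0' t' i) ?mulr0 ?subr0 in si; last first.
  by apply: lattice_separated hj; exact: nesym.
have sj := step j; rewrite (F0' t j) ?mulr0 ?sub0r ?normrN in sj; last first.
  exact: lattice_separated hi.
apply: (le_trans (ler_normB _ _)); lra.
Qed.

End bump_train.

Section scaled_bump.
Context (R : realType) (K : nat -> R -> R) (m l : nat) (CK : R).
Hypothesis Kchain : deriv_chain l K.
Hypothesis Ksupp : forall j t, (j <= l)%N -> 1 <= `|t| -> K j t = 0.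
Hypothesis Kbnd : forall j t, (j <= l)%N -> `|K j t| <= CK.

(** Normalized so that entry m has height of order w whatever h is; entry 0 is then smaller by the
    factor h^m, which is the gain brought by the noise. *)
Definition scaled_bump (w h s : R) (j : nat) (t : R) : R :=
  w * h ^+ m / h ^+ j * K j ((t - s) / h).

Lemma scaled_bump_chain w h s : 0 < h -> deriv_chain l (scaled_bump w h s).
Proof.
move=> h0 j jl t; rewrite /scaled_bump.
have da : is_derive t (1 : R) (fun t : R => (t - s) / h) h^-1.
  have -> : (fun t : R => (t - s) / h) = horner (h^-1 *: ('X - s%:P)).
    by apply/funext => u; rewrite hornerZ hornerXsubC mulrC.
  apply: is_derive_eq.
  by rewrite derivZ derivXsubC hornerZ hornerC mulr1.
have d1 := @is_derive1_comp _ (K j) (fun t : R => (t - s) / h) t _ _ (Kchain jl _) da.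
have d2 := is_deriveZ (w * h ^+ m / h ^+ j) d1.
apply: (is_derive_eq d2); rewrite /GRing.scale/= exprS.
by field; rewrite expf_neq0 ?gt_eqF.
Qed.

Lemma scaled_bump_supp w h s j t : 0 < h -> (j <= l)%N -> h <= `|t - s| ->
  scaled_bump w h s j t = 0.
Proof.
move=> h0 jl ht; rewrite /scaled_bump Ksupp ?mulr0//.
by rewrite normrM normfV (gtr0_norm h0) ler_pdivlMr// mul1r.
Qed.

Lemma scaled_bump_le w h s j t : 0 < h -> 0 <= w -> (j <= l)%N ->
  `|scaled_bump w h s j t| <= w * h ^+ m / h ^+ j * CK.
Proof.
move=> h0 w0 jl; have hp i : 0 <= h ^+ i by rewrite exprn_ge0// ltW.
have c0 : 0 <= w * h ^+ m / h ^+ j by rewrite divr_ge0// mulr_ge0.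
by rewrite normrM (ger0_norm c0); apply: ler_wpM2l => //; exact: Kbnd.
Qed.

Lemma holder_scaled_bump b w h s j :
  0 < b <= 1 -> 0 < h -> 0 <= w -> (j < l)%N ->
  holder b (w * h ^+ m / h ^+ j / h `^ b * (2 * CK)) (scaled_bump w h s j).
Proof.
move=> b01 h0 w0 jl t t'.
have hK : holder b (2 * CK) (K j).
  apply: (bounded_lipschitz_holder b01 (Kchain jl)) => u; apply: Kbnd => //.
  exact: ltnW.
have hp i : 0 <= h ^+ i by rewrite exprn_ge0// ltW.
have c0 : 0 <= w * h ^+ m / h ^+ j by rewrite divr_ge0// mulr_ge0.
rewrite /scaled_bump -mulrBr normrM (ger0_norm c0).
set C := w * h ^+ m / h ^+ j in c0 *.
rewrite -!(mulrA C); apply: ler_wpM2l => //.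
apply: (le_trans (hK _ _)).
have -> : (t - s) / h - (t' - s) / h = (t - t') / h by ring.
rewrite normrM normfV (gtr0_norm h0) powRM ?invr_ge0 ?(ltW h0)//.
rewrite -(powR_inv1 (ltW h0)) -powRrM mulN1r powRN.
by rewrite le_eqVlt; apply/orP; left; apply/eqP; ring.
Qed.

End scaled_bump.

Section hard_alternative.
Context (R : realType).
Local Notation mu := (@lebesgue_measure R).

Lemma exists_bump (m l : nat) : exists (K : nat -> R -> R) (CK : R),
  [/\ 0 < CK, deriv_chain l K,
      forall j t, (j <= l)%N -> 1 <= `|t| -> K j t = 0,
      forall j t, (j <= l)%N -> `|K j t| <= CK & K m 0 = 1].
Proof.
have bnd n : (n <= l)%N ->
    exists C, forall j (t : R), (j <= n)%N -> `|parab_bump l.+2 m j t| <= C.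
  elim: n => [|n IH] nl.
    have [C HC] := @bump_bounded R l.+2 m 0 isT.
    by exists C => j t; rewrite leqn0 => /eqP ->.
  have [C HC] := IH (ltnW nl).
  have [C' HC'] := @bump_bounded R l.+2 m n.+1 (leqW nl).
  exists (Num.max C C') => j t; rewrite leq_eqVlt => /orP[/eqP ->|jn].
    by rewrite le_max HC' orbT.
  by rewrite le_max HC.
have [C HC] := bnd l (leqnn l).
exists (parab_bump l.+2 m), (Num.max 1 C); split.
- by rewrite lt_max ltr01.
- exact: bump_chain.
- by move=> j t jl; apply: bump_eq0; rewrite ltnS leqW.
- by move=> j t jl; rewrite le_max HC ?orbT.
- exact: bump_peak.
Qed.

Lemma integral_sum_itv (n : nat) (c : 'I_n -> R) (h W : R) : 0 < h -> 0 <= W ->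
  measurable_fun [set: measurableTypeR R]
    (fun y => \sum_(i < n) W * \1_(`[c i - h, c i + h]%classic) y) /\
  (\int[mu]_y (\sum_(i < n) W * \1_(`[(c i - h)%R, (c i + h)%R]%classic) y)%:E =
    (n%:R * (W * (2 * h)))%:E)%E.
Proof.
move=> h0 W0.
have mI i : measurable_fun [set: measurableTypeR R]
    (fun y => W * \1_(`[c i - h, c i + h]%classic) y).
  by apply: measurable_funM => //; exact: measurable_indic.
split; first exact: measurable_sum.
under eq_integral do rewrite -sumEFin.
rewrite ge0_integral_sum//; last 2 first.
- by move=> i; apply/measurable_EFinP.
- by move=> i y _; rewrite lee_fin mulr_ge0.
transitivity (\sum_(i < n) (W * (2 * h))%:E)%E; last first.
  by rewrite sumEFin sumr_const card_ord [in RHS]mulr_natl.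
apply: eq_bigr => i _; under eq_integral do rewrite EFinM.
rewrite ge0_integralZl_EFin//; last exact/measurable_EFinP/measurable_indic.
rewrite integral_indic//= setIT lebesgue_measure_itv/= lte_fin ifT; last lra.
by rewrite -EFinB -EFinM; congr EFin; ring.
Qed.

(** Lattice point i0 sits at x0, and any other one is at most 2 theta (m + 1) M away, so the train
    stays within a distance of order M. The term m theta pays for the shift of argument caused by
    the m differences. *)
Lemma lattice_reach (m M i i0 : nat) (theta x0 h t : R) :
  0 < theta -> h <= theta -> (0 < M)%N ->
  (i < m.+1 * M)%N -> (i0 < m.+1 * M)%N ->
  `|t - (x0 - 2 * theta * i0%:R) - 2 * theta * i%:R| < h ->
  1 + `|t| + m%:R * theta <=
    (1 + `|x0| + m%:R * theta + 2 * theta * m.+1%:R + theta) * M%:R.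
Proof.
move=> theta0 hth M0 iM i0M; set u := t - _ - _ => hu.
have MR : 1 <= M%:R :> R by rewrite ler1n.
have iM' : i%:R <= m.+1%:R * M%:R :> R by rewrite -natrM ler_nat ltnW.
have i0M' : i0%:R <= m.+1%:R * M%:R :> R by rewrite -natrM ler_nat ltnW.
have ii0 : `|i%:R - i0%:R| <= m.+1%:R * M%:R :> R.
  rewrite ler_norml; have : 0 <= i%:R :> R by [].
  have : 0 <= i0%:R :> R by [].
  by move: iM' i0M'; clear => *; apply/andP; split; lra.
have tt0 : 0 <= 2 * theta by rewrite mulr_ge0// ltW.
have t_le : `|t| <= h + `|x0| + 2 * theta * (m.+1%:R * M%:R).
  have -> : t = u + x0 + 2 * theta * (i%:R - i0%:R) by rewrite /u; ring.
  apply: (le_trans (ler_normD _ _)); apply: lerD.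
    by apply: (le_trans (ler_normD _ _)); apply: lerD => //; exact: ltW.
  by rewrite normrM (ger0_norm tt0); apply: ler_wpM2l.
have e0 : 0 <= 1 + `|x0| + m%:R * theta + theta.
  by rewrite !addr_ge0// ?mulr_ge0// ltW.
have e1 : 1 + `|x0| + m%:R * theta + theta
    <= (1 + `|x0| + m%:R * theta + theta) * M%:R.
  by rewrite -[leLHS]mulr1; apply: ler_wpM2l.
have -> : (1 + `|x0| + m%:R * theta + 2 * theta * m.+1%:R + theta) * M%:R =
    (1 + `|x0| + m%:R * theta + theta) * M%:R + 2 * theta * (m.+1%:R * M%:R) by ring.
by move: t_le e1 hth; clear; lra.
Qed.

(** The constants a and C are chosen before A, h and M, from the slacks of f0, the noise and the
    bump. A Hölder slack proportional to A is available because A0 (1 - eta) + eta A <= A for A >=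
    A0. *)
Lemma perturbation (m : nat) (theta alpha q B x0 A0 : R) (htheta : 0 < theta)
    (f0 : density R) (F0 : nat -> R -> R) (eta delta c0 : R) :
  (0 < m)%N -> 0 < alpha -> 1 < q -> 0 < A0 ->
  F0 0%N = f0 -> deriv_chain (sfloor alpha) F0 ->
  continuous (F0 (sfloor alpha)) ->
  0 < eta < 1 ->
  holder (alpha - (sfloor alpha)%:R) (A0 * (1 - eta)) (F0 (sfloor alpha)) ->
  0 < delta -> (forall t, t != 0 -> f0 t <= (B - delta) * `|t| `^ (- q)) ->
  0 < c0 -> (forall t, c0 / (1 + `|t|) `^ q <= f0 t) ->
  exists a C : R, 0 < a /\ 0 <= C /\ forall (A h : R) (M : nat),
    A0 <= A -> 0 < h -> h <= theta -> (0 < M)%N ->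
    let v := A * h `^ alpha in M%:R `^ q * v <= 2 `^ q ->
    exists f1 : density R,
    [/\ W_class alpha q A B f1, a * v / m.+1%:R <= f1 x0 - f0 x0 &
      sq_dominated (1 + C * (v ^+ 2 * h ^+ (2 * m).+1
          * (M%:R * M%:R `^ q / M%:R ^+ (2 * m))))
        (Defs.conv (density_prob f0) (conv_pow (unif_sym htheta) m))
        (Defs.conv (density_prob f1) (conv_pow (unif_sym htheta) m))].
Proof.
move=> m0 a0 q1 A00 F00 dF0 cF0 /andP[eta0 eta1] holdF0 delta0 tailf0 c00 lowf0.
have b01 := sfloor_exponent a0.
set k := sfloor alpha in dF0 cF0 holdF0 b01 *.
have [K [CK [CK0 dK suppK bndK peakK]]] := exists_bump m (m + k).+1.
(* One derivative beyond order m + k, for the Hölder bound on entry m + k. *)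
set l := (m + k).+1 in dK suppK bndK.
have q0 : 0 <= q by lra.
set Q := conv_pow _ _.
have [kap kap0 lowQ] := obs_density_lower Q q0.
have mR : 0 <= m%:R :> R by [].
pose C1 := 1 + `|x0| + m%:R * theta + 2 * theta * m.+1%:R + theta.
have C11 : 1 <= C1.
  have := normr_ge0 x0; rewrite /C1 => ?.
  have : 0 <= m%:R * theta by rewrite mulr_ge0// ltW.
  have : 0 <= 2 * theta * m.+1%:R by rewrite !mulr_ge0// ltW.
  lra.
have C10 : 0 < C1 by lra.
(* On the train 1 + |t| <= C1 M, so M^q v <= 2^q gives (1 + |t|)^q v <= [bet]. *)
pose bet := (2 * C1) `^ q.
have bet0 : 0 < bet by rewrite powR_gt0// mulr_gt0.
pose cd := Num.min c0 delta.
have cd0 : 0 < cd by rewrite lt_min c00.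
(* The first term keeps the Hölder constant 4 CK a A of the train below eta A. The second keeps the
   perturbation below cd / (1 + |t|)^q, which yields positivity (c0) and the tail bound (delta) at
   once. *)
pose a := Num.min (eta / (4 * CK)) (cd / (bet * CK)).
have aa0 : 0 < a by rewrite lt_min !divr_gt0// mulr_gt0.
have a_eta : 4 * CK * a <= eta.
  rewrite mulrC -ler_pdivlMr ?mulr_gt0//; by rewrite ge_min lexx.
have a_cd : bet * CK * a <= cd.
  rewrite mulrC -ler_pdivlMr ?mulr_gt0//; by rewrite ge_min lexx orbT.
pose C := 2 * m.+1%:R * ((2 * theta) ^- m * 2 ^+ m * a * CK) ^+ 2 * C1 `^ q
  / (kap * c0).
exists a, C; split => //; split.
  apply: divr_ge0; last by rewrite mulr_ge0// ltW.
  apply: mulr_ge0; last exact: powR_ge0.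
  by apply: mulr_ge0; [rewrite mulr_ge0|exact: sqr_ge0].
move=> A h M AA h0 hth M0 v Mv.
have MR : 1 <= M%:R :> R by rewrite ler1n.
have MR0 : 0 < M%:R :> R by exact: lt_le_trans MR.
have A_0 : 0 < A by exact: lt_le_trans AA.
have v0 : 0 < v by rewrite mulr_gt0// powR_gt0.
have av0 : 0 <= a * v by rewrite mulr_ge0// ltW.
have hX i : 0 < h ^+ i by rewrite exprn_gt0.
pose p := train_coef R m M.
have p01 i : 0 <= p`_i <= 1 by exact: train_coef_bound.
have sp : (size p <= m.+1 * M)%N by exact: size_train_coef.
have [i0 i0M pi0] := train_coef_peak R m M0.
(* Shifts the train so that its lattice point of large weight falls on x0. *)
pose s := x0 - 2 * theta * i0%:R.
pose Phi := scaled_bump K m (a * v) h s.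
pose Psi j := lattice_conv theta p (Phi j).
have dPhi : deriv_chain l Phi by exact: scaled_bump_chain.
have dPsi : deriv_chain l Psi by exact: lattice_conv_chain.
have suppPhi j t : (j <= l)%N -> h <= `|t - s| -> Phi j t = 0.
  by move=> jl ht; exact: (scaled_bump_supp m suppK (a * v) h0 jl ht).
have contPsi j : (j < l)%N -> continuous (Psi j).
  by move=> jl; exact: is_derive_continuous (dPsi j jl).
have near_s (t : R) i : (i < m.+1 * M)%N -> `|t - s - 2 * theta * i%:R| < h ->
    1 + `|t| + m%:R * theta <= C1 * M%:R.
  by move=> iM hi; apply: lattice_reach hi.
have mth0 : 0 <= m%:R * theta by rewrite mulr_ge0// ltW.
have far_Psi j t : (j <= l)%N -> C1 * M%:R <= `|t| -> Psi j t = 0.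
  move=> jl tC.
  have [[_ //]|[i [ip hi _]]] := lattice_conv_single h0 hth p t (suppPhi j ^~ jl).
  by have := near_s t i (leq_trans ip sp) hi; move: tC mth0; clear; lra.
have psi_bound t : `|Psi m t| <= a * v * CK /\
    (Psi m t = 0 \/ 1 + `|t| <= C1 * M%:R).
  have ml : (m <= l)%N by rewrite /l ltnW// ltnS leq_addr.
  rewrite /Psi; have [[_ ->]|[i [ip hi ->]]] :=
      lattice_conv_single h0 hth p t (suppPhi m ^~ ml).
    by split; [rewrite normr0 mulr_ge0// ltW | left].
  split; last first.
    by right; have := near_s t i (leq_trans ip sp) hi; move: mth0; clear; lra.
  have /andP[pi0' pi1] := p01 i.
  rewrite normrM (ger0_norm pi0').
  have := @scaled_bump_le R K m l CK bndK (a * v) h s m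
    (t - 2 * theta * i%:R) h0 av0 ml.
  rewrite mulfK ?gt_eqF// -/(Phi m (t - 2 * theta * i%:R)).
  apply: le_trans; rewrite -[leRHS]mul1r; exact: ler_wpM2r.
have psi_small t : `|Psi m t| <= cd / (1 + `|t|) `^ q.
  have [le_t [->|t_le]] := psi_bound t.
    by rewrite normr0 divr_ge0 ?powR_ge0// ltW.
  apply: (le_trans le_t).
  have t1 : 0 < 1 + `|t| by rewrite ltr_pwDl.
  rewrite ler_pdivlMr ?powR_gt0//.
  have : (1 + `|t|) `^ q <= (C1 * M%:R) `^ q.
    by apply: ge0_ler_powR => //; rewrite nnegrE ltW// mulr_gt0.
  rewrite (powRM q (ltW C10) (ltW MR0)) => tq.
  have c1q : 0 <= C1 `^ q by exact: powR_ge0.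
  have Mv' : C1 `^ q * (M%:R `^ q * v) <= bet.
    by rewrite /bet (powRM q _ (ltW C10))// mulrC; apply: ler_wpM2r.
  apply: (@le_trans _ _ (a * v * CK * (C1 `^ q * M%:R `^ q))).
    by apply: ler_wpM2l => //; rewrite mulr_ge0// ltW.
  have -> : a * v * CK * (C1 `^ q * M%:R `^ q) =
    C1 `^ q * (M%:R `^ q * v) * (CK * a) by ring.
  apply: (@le_trans _ _ (bet * (CK * a))).
    by apply: ler_wpM2r => //; rewrite mulr_ge0// ltW.
  by rewrite mulrA.
have psi_c0 t : `|Psi m t| <= c0 / (1 + `|t|) `^ q.
  apply: (le_trans (psi_small t)); apply: ler_wpM2r; first by rewrite invr_ge0 powR_ge0.
  by rewrite ge_min lexx.
have psi_delta t : t != 0 -> `|Psi m t| <= delta * `|t| `^ (- q).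
  move=> t0; apply: (le_trans (psi_small t)); rewrite powRN.
  have tpos : 0 < `|t| by rewrite normr_gt0.
  have t1 : 0 < 1 + `|t| by rewrite ltr_pwDl.
  apply: ler_pM; [exact: ltW|by rewrite invr_ge0 powR_ge0|by rewrite ge_min lexx orbT|].
  rewrite lef_pV2 ?posrE ?powR_gt0//; apply: ge0_ler_powR; rewrite ?nnegrE ?(ltW t1)//.
  by rewrite lerDr.
have CM0 : 0 < C1 * M%:R by rewrite mulr_gt0.
have ml : (m < l)%N by rewrite /l ltnS leq_addr.
(* Here m > 0 matters: entry m is the derivative of the compactly supported entry m - 1. *)
have [f1 f1E] : exists g : density R, g = (fun t => f0 t + Psi m t) :> (R -> R).
  apply: (@perturb_density R f0 (Psi m.-1) (Psi m) (C1 * M%:R)) => //.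
  - by move=> t; have := dPsi m.-1 (leq_ltn_trans (leq_pred m) ml) t; rewrite prednK.
  - exact: contPsi.
  - by move=> t; apply: far_Psi; exact: ltnW.
  - by move=> t; apply: far_Psi; rewrite (leq_trans (leq_pred _))// ltnW.
  - move=> t; have := psi_c0 t; have := lowf0 t; rewrite ler_norml.
    by clear => ? /andP[]; lra.
exists f1; split.
- pose F1 j t := 1 * F0 j t + 1 * Psi (m + j)%N t.
  have dF1 : deriv_chain k F1.
    apply: deriv_chain_lincomb => // j jk t; rewrite addnS; apply: dPsi.
    by rewrite /l ltnS leq_add2l ltnW.
  have cF1 : continuous (F1 k).
    by apply: continuous_lincomb => //; apply: contPsi; rewrite /l.
  have f1F1 : F1 0%N = f1.
    by apply/funext => t; rewrite f1E /F1 F00 addn0 !mul1r.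
  split; first split.
  + by rewrite -f1F1; exact: chain_continuously_differentiable.
  + rewrite -/k -f1F1 (derive1n_chain dF1)//.
    have holdPhi := @holder_scaled_bump R K m l CK dK bndK (alpha - k%:R) (a * v) h s
      (m + k)%N b01 h0 av0 (ltnSn _).
    (* The choice v = A h^alpha makes the Hölder constant of a bump independent of h. *)
    have Lval : a * v * h ^+ m / h ^+ (m + k) / h `^ (alpha - k%:R) = a * A.
      have hb : h `^ alpha = h `^ (alpha - k%:R) * h ^+ k.
        rewrite -powR_mulrn ?(ltW h0)// -powRD ?(gt_eqF h0) ?implybT//.
        by rewrite subrK.
      rewrite /v hb exprD; field.
      by rewrite !expf_neq0 ?gt_eqF ?powR_gt0.
    rewrite Lval in holdPhi.
    have aA : 0 <= a * A * (2 * CK) by rewrite !mulr_ge0// ltW.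
    have mkl : (m + k <= l)%N by rewrite /l.
    have holdPsi := holder_lattice_conv h0 hth p01 (suppPhi _ ^~ mkl) aA holdPhi.
    have hold1 := holder_lincomb ler01 ler01 holdF0 holdPsi.
    apply: holder_le hold1.
    have : 4 * CK * a * A <= eta * A by apply: ler_wpM2r => //; exact: ltW.
    have : A0 * (1 - eta) <= A * (1 - eta).
      by apply: ler_wpM2r => //; rewrite subr_ge0 ltW.
    by clear; lra.
  + move=> t t0; rewrite f1E.
    have := tailf0 t t0; have := psi_delta t t0; rewrite ler_norml => /andP[_].
    by clear; lra.
- rewrite f1E addrC addKr.
  have ml' := ltnW ml.
  have i0s : (i0 < size p)%N.
    rewrite ltnNge; apply/negP => le_i0.
    by move: pi0; rewrite -/p nth_default// invr_le0 lern0.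
  have at_i0 : `|x0 - s - 2 * theta * i0%:R| = 0.
    by rewrite (_ : x0 - s - _ = 0) ?normr0// /s; ring.
  have [[far _]|[i [ip hi]]] := lattice_conv_single h0 hth p x0 (suppPhi m ^~ ml').
    by have := far i0 i0s; rewrite at_i0 leNgt h0.
  have [->|/eqP ii0] := eqVneq i i0; last first.
    have := @lattice_separated R theta h h0 hth (x0 - s) i i0 ii0 hi.
    by rewrite at_i0 leNgt h0.
  move=> E; rewrite [Psi m x0]E -/s /Phi /scaled_bump subrr mul0r peakK mulr1.
  rewrite mulfK ?gt_eqF//.
  by rewrite mulrC; apply: ler_wpM2r.
pose d := diff_coef R m M.
have sd : (size d <= m.+1 * M)%N by exact: size_diff_coef.
(* [X] bounds the noisy perturbation: the normalization of the m differences, the size of the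
   differenced weights, and the height of entry 0 of the bump. [W] bounds its square divided by the
   lower bound on the noisy null density, using 1 + |y| <= C1 M there. The intervals around [ctr i],
   moved by m theta, cover the support. *)
pose X := (2 * theta) ^- m * (2 ^+ m / M%:R ^+ m) * (a * v * h ^+ m * CK).
pose W := X ^+ 2 * (C1 * M%:R) `^ q / (kap * c0).
have kc0 : 0 < kap * c0 by exact: mulr_gt0.
have W0 : 0 <= W by rewrite divr_ge0 ?(ltW kc0)// mulr_ge0 ?sqr_ge0 ?powR_ge0.
pose ctr (i : 'I_(m.+1 * M)) := s - m%:R * theta + 2 * theta * i%:R.
have [mw Iw] := integral_sum_itv ctr h0 W0.
have t2 : 0 < (2 * theta) ^- m by rewrite invr_gt0 exprn_gt0// mulr_gt0.
have mll : (m <= l)%N := ltnW ml.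
apply: (@sq_dominated_conv R f0 f1 Q (iter m (cdiff theta) (Psi 0%N)) _
  (fun y => kap * c0 / (1 + `|y|) `^ q)) mw _ _ _ _ _ _.
- move=> y; apply: sumr_ge0 => i _; exact: mulr_ge0.
- by move=> y; rewrite divr_gt0// powR_gt0// ltr_pwDl.
- exact: lowQ.
- move=> y; apply: (@obs_density_perturb R theta htheta m f0 f1 Psi (a * v * CK) y).
  + by move=> j jm t; apply: dPsi; exact: ltn_trans jm ml.
  + exact: contPsi.
  + by move=> t; case: (psi_bound t).
  + by move=> t; rewrite f1E.
- move=> y; have t1 : 0 < 1 + `|y| by rewrite ltr_pwDl.
  have yq0 : 0 < (1 + `|y|) `^ q by exact: powR_gt0.
  rewrite iter_cdiff_lattice_conv -/(diff_coef R m M) -/d.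
  have [[_ ->]|[i [id hi ->]]] :=
      lattice_conv_single h0 hth d (y + m%:R * theta) (suppPhi 0%N ^~ (leq0n l)).
    rewrite mulr0 expr0n mulr_ge0 ?divr_ge0 ?(ltW kc0) ?(ltW yq0)//.
    by apply: sumr_ge0 => i _; exact: mulr_ge0.
  have iM : (i < m.+1 * M)%N := leq_trans id sd.
  have yC : 1 + `|y| <= C1 * M%:R.
    have := near_s _ _ iM hi; apply: le_trans.
    have := ler_normB (y + m%:R * theta) (m%:R * theta).
    rewrite addrK (ger0_norm mth0); clear; lra.
  set P := Phi 0%N _.
  have PX : `|(2 * theta) ^- m * (d`_i * P)| <= X.
    rewrite normrM (gtr0_norm t2) /X -(mulrA ((2 * theta) ^- m)).
    apply: ler_wpM2l; first exact: ltW.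
    rewrite normrM; apply: ler_pM => //; first exact: diff_coef_bound.
    have := @scaled_bump_le R K m l CK bndK (a * v) h s 0%N
      (y + m%:R * theta - 2 * theta * i%:R) h0 av0 (leq0n l).
    by rewrite expr0 divr1.
  have X2 : ((2 * theta) ^- m * (d`_i * P)) ^+ 2 <= X ^+ 2.
    rewrite -(real_normK (num_real _)) lerXn2r ?nnegrE//.
    exact: le_trans PX.
  apply: (le_trans X2).
  apply: (@le_trans _ _ (W * (kap * c0 / (1 + `|y|) `^ q))).
    rewrite /W mulrA divfK ?gt_eqF// ler_pdivlMr//.
    apply: ler_wpM2l; first exact: sqr_ge0.
    by apply: ge0_ler_powR => //; rewrite nnegrE ltW.
  apply: ler_wpM2r; first by rewrite divr_ge0// ltW.
  rewrite (bigD1 (Ordinal iM))//= indicE mem_set ?mulr1.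
    by rewrite lerDl; apply: sumr_ge0 => j _; exact: mulr_ge0.
  rewrite /= in_itv/= -ler_distl /ctr/=.
  have -> : y - (s - m%:R * theta + 2 * theta * i%:R) =
    y + m%:R * theta - s - 2 * theta * i%:R by ring.
  exact: ltW.
rewrite Iw lee_fin le_eqVlt; apply/orP; left; apply/eqP.
rewrite /W /X /C (powRM q (ltW C10) (ltW MR0)) natrM.
have -> : M%:R ^+ (2 * m) = M%:R ^+ m * M%:R ^+ m :> R by rewrite mul2n -addnn exprD.
have -> : h ^+ (2 * m).+1 = h ^+ m * h ^+ m * h by rewrite exprSr mul2n -addnn exprD.
have := hX m; have : 0 < M%:R ^+ m :> R by rewrite exprn_gt0.
have : 0 < (2 * theta) ^+ m by rewrite exprn_gt0// mulr_gt0.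
move: kap0 c00; clear.
move: ((2 * theta) ^+ m) (h ^+ m) (M%:R ^+ m) (2 ^+ m : R) => x1 x2 x3 x4 *.
by field; rewrite !gt_eqF.
Qed.

End hard_alternative.

(** * The rate *)

Section rate.
Context (R : realType).

(** After taking logarithms the claim is linear. The power of A in n cancels the one in h^(2m+1),
    the definition of nu cancels the rest, and only (q + 1 - 2m) ln M <= (r / alpha) ln v
    remains. *)
Lemma rate_balance (m : nat) (alpha q A N v h : R) :
  0 < alpha -> 1 < q -> 0 < A -> 0 < N ->
  let nu := rate_nu m alpha q in
  let n := A `^ ((2 * m%:R + 1) / alpha) * N in
  v = N `^ (- nu) -> v <= 1 -> h = (v / A) `^ (alpha^-1) ->
  exists M : nat, [/\ (0 < M)%N, M%:R `^ q * v <= 2 `^ q &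
    n * (v ^+ 2 * h ^+ (2 * m).+1 * (M%:R * M%:R `^ q / M%:R ^+ (2 * m))) <= 1].
Proof.
move=> a0 q1 A0 N0 nu n vE v1 hE.
have v0 : 0 < v by rewrite vE powR_gt0.
have vA : 0 < v / A by rewrite divr_gt0.
have h0 : 0 < h by rewrite hE powR_gt0.
have m0 : 0 <= m%:R :> R by [].
have r0 : 0 <= rate_r m alpha q.
  rewrite /rate_r; case: ltP => // qm; rewrite mulr_ge0 ?divr_ge0 ?ltW//; lra.
have lnv : ln v = - nu * ln N by rewrite vE ln_powR.
have lnh : ln h = alpha^-1 * (ln v - ln A) by rewrite hE ln_powR ln_div.
have den0 : 0 < 2 * alpha + 2 * m%:R + 1 + rate_r m alpha q by lra.
have nuE : nu * (2 * alpha + 2 * m%:R + 1 + rate_r m alpha q) = alpha.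
  by rewrite /nu /rate_nu divfK// gt_eqF.
have nu0 : nu != 0 by rewrite /nu /rate_nu mulf_neq0 ?invr_neq0 ?gt_eqF.
have lnN : alpha * ln N = - (2 * alpha + 2 * m%:R + 1 + rate_r m alpha q) * ln v.
  by rewrite lnv -{1}nuE; ring.
have n0 : 0 < n by rewrite mulr_gt0 ?powR_gt0.
have key (M : nat) : (0 < M)%N ->
    (q + 1 - 2 * m%:R) * ln M%:R <= rate_r m alpha q / alpha * ln v ->
    n * (v ^+ 2 * h ^+ (2 * m).+1 * (M%:R * M%:R `^ q / M%:R ^+ (2 * m))) <= 1.
  move=> M0 HM; have MR : 0 < M%:R :> R by rewrite ltr0n.
  have hM (x y : R) : 0 < x -> 0 < y -> ln (x * y) = ln x + ln y.
    by move=> x0 y0; rewrite lnM ?posrE.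
  have hX (x : R) k : 0 < x -> ln (x ^+ k) = k%:R * ln x.
    by move=> x0; rewrite lnXn// [RHS]mulr_natl.
  have p1 : 0 < v ^+ 2 * h ^+ (2 * m).+1 by rewrite mulr_gt0 ?exprn_gt0.
  have p3 : 0 < M%:R * M%:R `^ q :> R by rewrite mulr_gt0// powR_gt0.
  have p4 : 0 < M%:R ^+ (2 * m) :> R by rewrite exprn_gt0.
  have p2 : 0 < M%:R * M%:R `^ q / M%:R ^+ (2 * m) :> R by rewrite divr_gt0.
  set P := n * _; have P0 : 0 < P by rewrite mulr_gt0// mulr_gt0.
  have lnP : ln P = (q + 1 - 2 * m%:R) * ln M%:R - rate_r m alpha q / alpha * ln v.
    rewrite /P (hM _ _ n0 (mulr_gt0 p1 p2)) (hM _ _ p1 p2) /n.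
    rewrite (hM _ _ (powR_gt0 _ A0) N0) (hM _ _ (exprn_gt0 2 v0) (exprn_gt0 _ h0)).
    rewrite ln_div ?posrE// (hM _ _ MR (powR_gt0 _ MR)) !ln_powR.
    rewrite (hX _ _ v0) (hX _ _ h0) (hX _ _ MR) lnh -[(2 * m).+1%:R]natr1 natrM.
    have -> : ln N = - (2 * alpha + 2 * m%:R + 1 + rate_r m alpha q) * ln v / alpha.
      by rewrite -lnN; field; rewrite gt_eqF.
    by field; rewrite gt_eqF.
  rewrite -(@lnK _ P) ?posrE// -expR0 ler_expR lnP; lra.
rewrite /rate_r in key; case: ltP key => qm key.
  (* Up to constants, the longest train allowed by M^q v <= 2^q; the coefficient of ln M is negative
     here, so long trains help. Rounding up at most doubles x because x >= 1, whence the bound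
     2^q. *)
  pose x := v `^ (- q^-1).
  have q0 : 0 < q by lra.
  have x1 : 1 <= x.
    rewrite /x powRN invf_ge1 ?powR_gt0//.
    rewrite -[leRHS](powRr0 v) ; apply: ger_powR; first by rewrite v0.
    by rewrite invr_ge0 ltW.
  have x0 : 0 <= x by lra.
  exists (Num.truncn x).+1.
  have /andP[t1 t2] := truncn_itv x0.
  have lnx : ln x = - q^-1 * ln v by rewrite /x ln_powR.
  split => //.
    have M2 : (Num.truncn x).+1%:R <= 2 * x by rewrite -natr1; lra.
    apply: (@le_trans _ _ ((2 * x) `^ q * v)).
      rewrite ler_wpM2r ?(ltW v0)//; apply: ge0_ler_powR; rewrite ?nnegrE//.
        exact: ltW.
      lra.
    rewrite powRM// /x -powRrM mulNr mulVf ?gt_eqF// powR_inv1 ?(ltW v0)//.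
    by rewrite -mulrA mulVf ?mulr1// gt_eqF.
  apply: key => //.
  have lnM : - q^-1 * ln v <= ln (Num.truncn x).+1%:R.
    by rewrite -lnx ler_ln ?posrE ?ltr0n//; lra.
  have -> : alpha / q * (2 * m%:R - 1 - q) / alpha * ln v =
     (q + 1 - 2 * m%:R) * (- q^-1 * ln v) by field; rewrite !gt_eqF.
  rewrite ler_wnM2l//; lra.
(* For q >= 2m - 1 the coefficient of ln M is nonnegative, so lengthening the train brings
   nothing. *)
exists 1%N; split => //.
  rewrite powR1 mul1r (le_trans v1)// -[leLHS](powRr0 2); apply: ler_powR; lra.
by apply: key => //; rewrite ln1 mulr0 !mul0r.
Qed.

End rate.

(** * From two densities to the minimax lower bound *)

Lemma limn_einf_ge (R : realType) (u : nat -> \bar R) (l : \bar R) (N : nat) :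
  (forall n, (N <= n)%N -> (l <= u n)%E) -> (l <= limn_einf u)%E.
Proof.
move=> lu; rewrite limn_einf_lim (cvg_lim _ (@cvg_einfs_sup _ u))//.
apply: (@le_trans _ _ (einfs u N)); last first.
  by apply: ereal_sup_ubound; exists N.
by apply: le_ereal_inf_tmp => _ [n /= Nn <-]; exact: lu.
Qed.

Lemma sq_dominated_le d (T : measurableType d) (R : realType) (c c' : R)
    (P0 P1 : probability T R) : c <= c' ->
  sq_dominated c P0 P1 -> sq_dominated c' P0 P1.
Proof.
move=> cc dom phi mphi phi01; apply: (le_trans (dom phi mphi phi01)).
apply: lee_wpmul2r; last by rewrite lee_fin.
apply: integral_ge0 => x _; case/andP: (phi01 x) => ? _.
exact: mule_ge0.
Qed.

Lemma minimax_risk_two_point (R : realType)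
    (G : probability (measurableTypeR R) R)
    (n : nat) (x0 s c : R) (F : set (density R)) (f0 f1 : density R) :
  1 <= c -> 0 <= s -> 2 * s <= `|f0 x0 - f1 x0| -> F f0 -> F f1 ->
  sq_dominated c (iid_law (Defs.conv (density_prob f0) G) n)
    (iid_law (Defs.conv (density_prob f1) G) n) ->
  (((s ^+ 2 / (4 * c)) `^ 2^-1)%:E <= minimax_risk G n x0 F)%E.
Proof.
move=> c1 s0 sep Ff0 Ff1 dom.
apply: le_ereal_inf_tmp => _ [fhat _ <-].
have s40 : 0 <= s ^+ 2 / (4 * c) by rewrite divr_ge0 ?sqr_ge0// mulr_ge0//; lra.
have root (f : density R) : F f ->
    ((s ^+ 2 / (4 * c))%:E <= 'E_(iid_law (Defs.conv (density_prob f) G) n)[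
      (fun y => `|fhat y - f x0| ^+ 2)%R])%E ->
    (((s ^+ 2 / (4 * c)) `^ 2^-1)%:E <= ereal_sup [set rmse G x0 fhat f | f in F])%E.
  move=> Ff le_f; apply: (@le_trans _ _ (rmse G x0 fhat f)).
    rewrite /rmse -poweR_EFin; apply: gt0_ler_poweR => //.
    - by rewrite in_itv/= lee_fin s40 leey.
    - rewrite in_itv/= leey andbT; apply: le_trans le_f.
      by rewrite lee_fin.
  by apply: ereal_sup_ubound; exists f.
have [] := two_point_lower_bound fhat c1 s0 sep dom; exact: root.
Qed.

(** The class is empty for small A, and its risk is then -oo, so A is kept above a threshold A0. A
    nonempty class with a strictly smaller constant provides the Hölder slack of the null density,
    which is built once for A0 and makes [C2] the same for all larger A. *)
Theorem theorem2 (R : realType) (m : nat) (theta alpha q B x0 A0 : R)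
    (hm : (0 < m)%N) (htheta : 0 < theta) (halpha : 0 < alpha)
    (hq : 1 < q) (hB : 0 < B)
    (hA0 : exists A', 0 < A' < A0 /\ W_class alpha q A' B !=set0) :
  exists C2 : R, 0 < C2 /\
    forall A : R, A0 <= A ->
      (C2%:E <= limn_einf (fun n : nat =>
        ((A `^ (- (2 * m%:R + 1) / alpha) * n%:R) `^ rate_nu m alpha q)%:E *
        minimax_risk (conv_pow (unif_sym htheta) m) n x0
          (W_class alpha q A B)))%E.
Proof.
case: hA0 => A1 [A1A0 ne].
have A00 : 0 < A0 by case/andP: A1A0 => /lt_trans; exact.
have [f0 [F0 [eta [delta [c0 [[F00 dF0 cF0]
    [eta01 holdF0 delta0 tailf0 [c00 lowf0]]]]]]]] :=
  null_density halpha hq hB A1A0 ne.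
have [a [C [a0 [C0 pert]]]] := perturbation x0 htheta hm halpha hq A00 F00 dF0 cF0
  eta01 holdF0 delta0 tailf0 c00 lowf0.
(* Half the separation at x0 is a v / (2 (m + 1)), and [expR C] bounds the domination constant of
   the whole sample. *)
pose kap := (a / (2 * m.+1%:R)) ^+ 2 / (4 * expR C).
have kap0 : 0 < kap.
  by rewrite divr_gt0 ?exprn_gt0 ?divr_gt0 ?mulr_gt0 ?expR_gt0.
exists (kap `^ 2^-1); split; first exact: powR_gt0.
move=> A AA; have A_0 : 0 < A by exact: lt_le_trans AA.
have f0W : W_class alpha q A B f0.
  have cd0 := chain_continuously_differentiable dF0 cF0.
  split; first split.
  - by rewrite -F00.
  - rewrite -F00 (derive1n_chain dF0)//.
    apply: holder_le holdF0; case/andP: eta01 => eta0 eta1.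
    by apply: le_trans AA; rewrite ger_pMr//; lra.
  - move=> t t0; apply: (le_trans (tailf0 t t0)).
    by apply: ler_wpM2r; [exact: powR_ge0|lra].
set nu := rate_nu m alpha q; set e1 := _ `^ (_ / alpha).
have nu0 : 0 < nu.
  rewrite divr_gt0//; have mR : 0 <= m%:R :> R by [].
  have r0 : 0 <= rate_r m alpha q.
    rewrite /rate_r; case: ltP => // qm.
    by rewrite mulr_ge0 ?divr_ge0//; lra.
  by move: (rate_r _ _ _) r0 => r r0; lra.
have e10 : 0 < e1 by exact: powR_gt0.
(* v <= 1 is required for balancing the rate, and v <= A theta^alpha amounts to h <= theta. Both
   hold for n beyond a threshold that may depend on A, which is harmless in the limit inferior. *)
pose e := Num.min 1 (A * theta `^ alpha).
have e0 : 0 < e by rewrite lt_min ltr01 mulr_gt0// powR_gt0.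
pose N0 := e `^ (- nu^-1) / e1.
apply: (@limn_einf_ge _ _ _ (Num.truncn N0).+1) => n nN0.
have n0 : 0 < n%:R :> R by rewrite ltr0n (leq_trans _ nN0).
have N0n : N0 <= n%:R.
  by rewrite (le_trans (ltW (truncnS_gt N0)))// ler_nat.
set N := e1 * n%:R; have N_0 : 0 < N by rewrite mulr_gt0.
pose v := N `^ (- nu).
have ve : v <= e by apply: powRN_le => //; rewrite /N mulrC -ler_pdivrMr.
have v1 : v <= 1 by rewrite (le_trans ve)// ge_min lexx.
have v0 : 0 < v by exact: powR_gt0.
pose h := (v / A) `^ (alpha^-1).
have h0 : 0 < h by rewrite powR_gt0// divr_gt0.
have hE : A * h `^ alpha = v.
  rewrite /h -powRrM mulVf ?gt_eqF// powRr1 ?divr_ge0 ?ltW//.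
  by rewrite mulrC divfK ?gt_eqF.
have hth : h <= theta.
  rewrite -(powRr1 (ltW htheta)) -(@mulfV _ alpha) ?gt_eqF// powRrM /h.
  apply: ge0_ler_powR; rewrite ?nnegrE ?invr_ge0 ?(ltW halpha) ?powR_ge0//.
    by rewrite divr_ge0// ltW.
  by rewrite ler_pdivrMr// mulrC (le_trans ve)// ge_min lexx orbT.
have [M [M0 Mv Mn]] := rate_balance halpha hq A_0 N_0 (erefl v) v1 (erefl h) (m := m).
have [f1 [f1W sep dom]] : exists f1 : density R, [/\ W_class alpha q A B f1,
    a * v / m.+1%:R <= f1 x0 - f0 x0 &
    sq_dominated (1 + C * (v ^+ 2 * h ^+ (2 * m).+1
          * (M%:R * M%:R `^ q / M%:R ^+ (2 * m))))
        (Defs.conv (density_prob f0) (conv_pow (unif_sym htheta) m))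
        (Defs.conv (density_prob f1) (conv_pow (unif_sym htheta) m))].
  by have := pert A h M AA h0 hth M0; rewrite hE; exact.
have nE : A `^ ((2 * m%:R + 1) / alpha) * N = n%:R.
  rewrite /N /e1 mulrA -powRD ?(gt_eqF A_0) ?implybT//.
  by rewrite mulNr addrN powRr0 mul1r.
rewrite nE in Mn.
set chi := v ^+ 2 * _ * _ in dom Mn.
have chi0 : 0 <= chi.
  by rewrite !mulr_ge0 ?exprn_ge0 ?invr_ge0 ?exprn_ge0 ?powR_ge0// ltW.
have Cchi : 0 <= 1 + C * chi by rewrite addr_ge0// mulr_ge0.
have domn := sq_dominated_iid (n := n) Cchi dom.
(* From 1 + x <= exp x and n chi <= 1. *)
have chin : (1 + C * chi) ^+ n <= expR C.
  apply: (@le_trans _ _ (expR (C * chi) ^+ n)).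
    by rewrite lerXn2r ?nnegrE ?expR_ge0// expR_ge1Dx.
  rewrite -expRM_natl ler_expR mulrCA -[leRHS]mulr1.
  exact: ler_wpM2l.
have risk := minimax_risk_two_point (s := a * v / (2 * m.+1%:R)) (c := expR C)
  _ _ _ f0W f1W (sq_dominated_le chin domn).
have mS : 0 < m.+1%:R :> R by rewrite ltr0n.
have kv : ((a * v / (2 * m.+1%:R)) ^+ 2 / (4 * expR C)) `^ 2^-1 = kap `^ 2^-1 * v.
  have -> : (a * v / (2 * m.+1%:R)) ^+ 2 / (4 * expR C) = kap * v ^+ 2.
    by rewrite /kap; field; rewrite !gt_eqF// expR_gt0.
  rewrite powRM ?(ltW kap0) ?sqr_ge0//; congr (_ * _).
  by rewrite -powR_mulrn ?(ltW v0)// -powRrM mulfV ?powRr1 ?(ltW v0).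
rewrite kv in risk.
(* The normalization cancels v exactly, since N^nu v = 1. *)
apply: (@le_trans _ _ ((N `^ nu)%:E * (kap `^ 2^-1 * v)%:E)%E).
  rewrite -EFinM lee_fin mulrCA /v powRN mulfV ?mulr1// gt_eqF//.
  exact: powR_gt0.
apply: lee_wpmul2l; first by rewrite lee_fin powR_ge0.
apply: risk.
- by rewrite -expR0 ler_expR.
- by rewrite divr_ge0 ?mulr_ge0 ?ltW.
rewrite distrC ger0_norm; last first.
  by apply: le_trans sep; rewrite divr_ge0 ?mulr_ge0 ?ltW.
apply: le_trans sep; rewrite le_eqVlt; apply/orP; left; apply/eqP.
by field; rewrite gt_eqF.
Qed.
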